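(* Let $|\nu|\le\frac12$, $0\le\alpha<1$ and $\beta\ge0$. Then the radius of $\beta$-uniform convexity of order $\alpha$, $r_{v_\nu}^{\beta-uc(\alpha)}$, of the function $v_\nu$ is the smallest positive root $r$ of the equation $$(1-\alpha)-(1+\beta)\left(1+\nu-r\,\frac{(1-\nu)\mathbf{H}_\nu'(r)+r\,\mathbf{H}_\nu''(r)}{-\nu\,\mathbf{H}_\nu(r)+r\,\mathbf{H}_\nu'(r)}\right)=0.$$ Moreover, $r_{v_\nu}^{\beta-uc(\alpha)}<r_{v_\nu}^{c}<\varsigma_{\nu,1}<h_{\nu,1}$, where $h_{\nu,1}$ and $\varsigma_{\nu,1}$ denote the first positive zeros of $\mathbf{H}_\nu$ and $v_\nu'$, respectively, and $r_{v_\nu}^{c}$ is the radius of convexity of $v_\nu$.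
   Context: Primes on functions denote derivatives. The Struve function of the first kind is $$\mathbf{H}_\nu(z)=\frac{\left(\frac z2\right)^{\nu+1}}{\sqrt{\frac{\pi}{4}}\,\Gamma\left(\nu+\frac32\right)}\,{}_1F_2\left(1;\tfrac32,\nu+\tfrac32;-\tfrac{z^2}{4}\right).$$ The normalized function is $v_\nu(z)=\sqrt\pi\,2^\nu z^{-\nu}\,\Gamma\left(\nu+\frac32\right)\mathbf{H}_\nu(z)=z\,{}_1F_2\left(1;\frac32,\nu+\frac32;-\frac{z^2}{4}\right)$. For $f(z)=z+\sum_{n\ge2}a_nz^n$ with radius of convergence $r_f\in(0,\infty]$ and $U(r)=\{z\in\mathbb{C}:|z|<r\}$, the radius of convexity is $$r_f^{c}=\sup\left\{r\in(0,r_f):\Re\left(1+\frac{zf''(z)}{f'(z)}\right)>0,\ z\in U(r)\right\},$$ and for $\beta\ge0$, $\alpha\in[0,1)$ the radius of $\beta$-uniform convexity of order $\alpha$ is $$r_f^{\beta-uc(\alpha)}=\sup\left\{r\in(0,r_f):\Re\left(1+\frac{zf''(z)}{f'(z)}\right)>\beta\left|\frac{zf''(z)}{f'(z)}\right|+\alpha,\ z\in U(r)\right\}.$$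
   Formalization: The strict inequality between the radius of β-uniform convexity of order α and the radius of convexity is asserted only when α > 0 or β > 0; for α = β = 0 the two radii coincide by definition, so only ≤ is asserted there. *)

(* Defs.v *)
(* Stdlib reals and Coquelicot, with Coquelicot's complex numbers [C]. *)
From Stdlib Require Import Reals Factorial.
From Coquelicot Require Export Coquelicot.
Open Scope R_scope.

(* Sum of a complex series, componentwise as in Coquelicot's [C_lim]. *)
Definition CSeries (a : nat -> C) : C :=
  (Series (fun n => Re (a n)), Series (fun n => Im (a n))).

(* Euler's integral; it converges exactly for [0 < x]. *)
Definition Gamma (x : R) : R :=
  RInt_gen (fun t => Rpower t (x - 1) * exp (- t))
    (at_right 0) (Rbar_locally p_infty).

Fixpoint pochhammer (a : R) (n : nat) : R :=
  match n with
  | O => 1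
  | S m => pochhammer a m * (a + INR m)
  end.

Definition hypergeometric_1F2 (a b c : R) (z : C) : C :=
  CSeries (fun n =>
    (RtoC (pochhammer a n / (pochhammer b n * pochhammer c n * INR (fact n)))
     * z ^ n)%C).

(* Principal argument, in (-PI, PI].  Off the real axis it is computed by the
   half-angle formula tan (arg z / 2) = Im z / (|z| + Re z). *)
Definition Carg (z : C) : R :=
  if Req_EM_T (Im z) 0 then (if Rlt_dec (Re z) 0 then PI else 0)
  else 2 * atan (Im z / (Cmod z + Re z)).

(* Principal branch of z ^ a for a real exponent.  The value 0 at z = 0 is the
   right one for a > 0, and is needed because [Rpower 0 a = 1] in Stdlib. *)
Definition Cpower (z : C) (a : R) : C :=
  if Ceq_dec z 0 then RtoC 0
  else (RtoC (Rpower (Cmod z) a) * (cos (a * Carg z), sin (a * Carg z)))%C.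

Definition struve (nu : R) (z : C) : C :=
  (Cpower (z / 2) (nu + 1) / RtoC (sqrt (PI / 4) * Gamma (nu + 3 / 2))
   * hypergeometric_1F2 1 (3 / 2) (nu + 3 / 2) (- (z ^ 2 / 4)))%C.

(* The entire function sqrt PI * 2 ^ nu * z ^ (- nu) * Gamma (nu + 3 / 2)
   * struve nu z. *)
Definition struve_v (nu : R) (z : C) : C :=
  (z * hypergeometric_1F2 1 (3 / 2) (nu + 3 / 2) (- (z ^ 2 / 4)))%C.

(* Radius of convergence of the Taylor series of [f] at 0, for an [f] given as
   the sum of that series: the supremum of the radii of the discs on which [f]
   is the sum of a power series. *)
Definition conv_radius (f : C -> C) : Rbar :=
  Lub_Rbar (fun r => 0 < r /\
    exists a : nat -> C, forall z : C, Cmod z < r ->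
      @is_pseries C_AbsRing C_NormedModule a z (f z)).

(* z f''(z) / f'(z) *)
Definition convexity_quotient (f : C -> C) (z : C) : C :=
  (z * C_derive (C_derive f) z / C_derive f z)%C.

(* In the two radii below, [C_derive f z <> 0] expresses that the quotient is
   defined; it is needed since division by 0 is total here. *)
Definition radius_of_convexity (f : C -> C) : Rbar :=
  Lub_Rbar (fun r => 0 < r /\ Rbar_lt r (conv_radius f) /\
    forall z : C, Cmod z < r ->
      C_derive f z <> 0 /\ Re (1 + convexity_quotient f z)%C > 0).

Definition radius_of_uniform_convexity (beta alpha : R) (f : C -> C) : Rbar :=
  Lub_Rbar (fun r => 0 < r /\ Rbar_lt r (conv_radius f) /\
    forall z : C, Cmod z < r ->
      C_derive f z <> 0 /\
      Re (1 + convexity_quotient f z)%C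
        > beta * Cmod (convexity_quotient f z) + alpha).

Definition is_smallest_positive (P : R -> Prop) (r : R) : Prop :=
  0 < r /\ P r /\ forall x : R, 0 < x -> P x -> r <= x.

Definition struve_denominator (nu : R) (z : C) : C :=
  (- RtoC nu * struve nu z + z * C_derive (struve nu) z)%C.

(* A root must not be a zero of the denominator, where the left-hand side of
   the equation is undefined. *)
Definition uniform_convexity_root (nu alpha beta : R) (r : R) : Prop :=
  struve_denominator nu r <> 0 /\
  ((1 - RtoC alpha) - (1 + RtoC beta) *
    (1 + RtoC nu - RtoC r *
      (((1 - RtoC nu) * C_derive (struve nu) r
        + RtoC r * C_derive (C_derive (struve nu)) r)
       / struve_denominator nu r)) = 0)%C.

(* Main.v *)
Require Import Defs.
From Stdlib Require Import Reals Factorial Lra Lia List.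
From Coquelicot Require Import Coquelicot.
Open Scope R_scope.

(** Put s = nu + 1/2, so that 0 <= s <= 1, and let m_j = j! / (s+1)_j be the moments
    of the beta law with parameters 1 and s (for s = 0, the unit mass at 1).
    The hypergeometric series gives v'(z) = G(z^2) and z v''(z) = 2 E(z^2), where
    G(y) = sum (-1)^j m_j y^j / (2j)! and E(y) = y G'(y).  In other words v'(z) is
    the mean of cos(z t) when t^2 follows the beta law.

    The heart of the matter is that all zeros of G are positive.  If G were a
    finite product of factors 1 - y/t with t > 0, then, for |y| <= r and r less than
    every t, a comparison factor by factor would give
      G(r) <= |G(y)|   and   |E(y)| G(r) <= - E(r) |G(y)|.
    These two inequalities ([beta_cos_bounds]) are all that is used of the zeros,
    and they survive limits, so it is enough to approximate G by polynomials with
    positive zeros.  The approximation replaces the law of t by a law on the points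
    k/N whose weights W_k increase with k.  The sum of the W_k cos(k theta) then
    changes sign N times on (0, pi), by the argument of Polya and of Enestrom and
    Kakeya ([increasing_cos_sum_alternates]); it is a polynomial of degree N in
    sin^2(theta/2), so it has N positive zeros.  The weights are chosen so that
    their central factorial moments have a closed form ([beta_weight_moment]), and
    convergence of the coefficients becomes visible; [tannery] turns it into
    convergence of the functions.

    With q = z v''/v', the inequalities say that |q(z)| is at most -q(|z|) below the
    first zero of v', so Re(1 + q) - beta |q| - alpha is at least
    (1 - alpha) + (1 + beta) q(|z|), with equality at z = |z| when q is nonpositive
    there.  Hence the radius is the first zero of (1 - alpha) v' + (1 + beta) z v''
    on the positive axis ([radius_of_uniform_convexity_struve_v]), and on that axis
    the equation in the Struve function reduces to this one, because H_nu is x^nu v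
    up to a constant ([uniform_convexity_root_iff]); the constant contains
    Gamma(nu + 3/2), whence the need for [Gamma_positive].

    The chain of inequalities is Rolle's theorem.  The quotients W_k/k increase too,
    which gives v(2 pi) <= 0 ([beta_sinc_nonpos]), so v has a first positive zero h;
    v' vanishes between 0 and h, for the first time at c say; (x v'(x))' = v' + x v''
    vanishes between 0 and c, and its first zero is the radius of convexity.  There
    (1 - alpha) v' + (1 + beta) x v'' equals -(alpha + beta) v' <= 0, so the first
    zero of this function comes no later. *)

(** * Finite sums and dominated convergence of series *)

Lemma sum_n_succ (a : nat -> R) (n : nat) : sum_n a (S n) = sum_n a n + a (S n) :> R.
Proof. exact (sum_Sn a n). Qed.

Lemma sum_n_zero (a : nat -> R) : sum_n a 0 = a 0%nat :> R.
Proof. exact (sum_O a). Qed.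

Lemma sum_n_scale (c : R) (f : nat -> R) (N : nat) :
  sum_n (fun k => c * f k) N = c * sum_n f N :> R.
Proof.
  induction N as [|N IH]; [now rewrite !sum_n_zero|]. rewrite !sum_n_succ, IH. ring.
Qed.

Lemma sum_n_telescope (W : nat -> R) (n : nat) :
  sum_n (fun k => W (S k) - W k) n = W (S n) - W 0%nat.
Proof.
  induction n as [|n IH]; [now rewrite sum_n_zero|].
  rewrite sum_n_succ, IH. simpl. ring.
Qed.

Lemma inv_INR_limit : is_lim_seq (fun n => / INR (S n)) 0.
Proof.
  apply (is_lim_seq_incr_1 (fun n => / INR n)).
  replace (Finite 0) with (Rbar_inv p_infty) by reflexivity.
  apply is_lim_seq_inv; [apply is_lim_seq_INR|discriminate].
Qed.

Lemma INR_S_pos (n : nat) : 0 < INR (S n).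
Proof. apply lt_0_INR. lia. Qed.

Lemma is_lim_seq_sum_n (a : nat -> nat -> R) (l : nat -> R) (J : nat) :
  (forall j, (j <= J)%nat -> is_lim_seq (fun N => a N j) (l j)) ->
  is_lim_seq (fun N => sum_n (a N) J) (sum_n l J).
Proof.
  intros H. induction J as [|J IH].
  - rewrite sum_O. apply (is_lim_seq_ext (fun N => a N 0%nat)); [intros N; rewrite sum_O; reflexivity|].
    apply H; lia.
  - rewrite sum_Sn.
    apply (is_lim_seq_ext (fun N => sum_n (a N) J + a N (S J))); [intros N; rewrite sum_Sn; reflexivity|].
    apply (is_lim_seq_plus' (fun N => sum_n (a N) J) (fun N => a N (S J))).
    + apply IH; intros; apply H; lia.
    + apply H; lia.
Qed.

Lemma ex_series_dominated (a B : nat -> R) :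
  (forall j, Rabs (a j) <= B j) -> ex_series B -> ex_series a.
Proof.
  intros HB HsB. apply (ex_series_le (K := R_AbsRing) (V := R_CompleteNormedModule) a B); auto.
Qed.

Lemma Series_split_S (a : nat -> R) (J : nat) :
  ex_series a -> Series a = sum_n a J + Series (fun k => a (S J + k)%nat).
Proof.
  intros H. rewrite (Series_incr_n a (S J)); [|lia|exact H].
  rewrite sum_n_Reals. reflexivity.
Qed.

Lemma is_lim_seq_Series_tail (B : nat -> R) :
  ex_series B -> is_lim_seq (fun J => Series (fun k => B (S J + k)%nat)) 0.
Proof.
  intros H.
  apply is_lim_seq_ext with (fun J => Series B - sum_n B J).
  - intros J. rewrite (Series_split_S B J H). ring.
  - replace (Finite 0) with (Finite (Series B - Series B)) by (f_equal; ring).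
    apply is_lim_seq_minus'; [apply is_lim_seq_const|].
    apply Series_correct in H. exact H.
Qed.

Lemma is_lim_seq_dominated_abs (l : R) (u : nat -> R) (b : R) :
  (forall n, Rabs (u n) <= b) -> is_lim_seq u l -> Rabs l <= b.
Proof.
  intros H Hl.
  apply (is_lim_seq_le (fun n => Rabs (u n)) (fun _ => b) (Rabs l) b H).
  - apply (is_lim_seq_abs u l Hl).
  - apply is_lim_seq_const.
Qed.

(** Dominated convergence for series; it turns coefficientwise convergence of the
    approximants into convergence of their sums. *)
Lemma tannery (a : nat -> nat -> R) (l B : nat -> R) :
  (forall N j, Rabs (a N j) <= B j) -> ex_series B ->
  (forall j, is_lim_seq (fun N => a N j) (l j)) ->
  is_lim_seq (fun N => Series (a N)) (Series l).
Proof.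
  intros Hb HB Hl.
  assert (Hlb : forall j, Rabs (l j) <= B j)
    by (intros j; exact (is_lim_seq_dominated_abs _ _ _ (fun N => Hb N j) (Hl j))).
  assert (Hexa : forall N, ex_series (a N))
    by (intros N; exact (ex_series_dominated _ _ (Hb N) HB)).
  assert (Hexl : ex_series l) by exact (ex_series_dominated _ _ Hlb HB).
  apply is_lim_seq_spec. intros eps.
  pose proof (is_lim_seq_Series_tail B HB) as Ht.
  apply is_lim_seq_spec in Ht.
  assert (He : 0 < eps / 3) by (destruct eps; simpl; lra).
  destruct (Ht (mkposreal _ He)) as [J HJ].
  specialize (HJ J (le_n J)). cbn [pos] in HJ.
  assert (HBs : ex_series (fun k => B (S J + k)%nat)) by (apply (ex_series_incr_n B (S J)); exact HB).
  assert (Htail : forall c, (forall j, Rabs (c j) <= B j) ->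
      Rabs (Series (fun k => c (S J + k)%nat)) <= Series (fun k => B (S J + k)%nat)).
  { intros c Hc.
    eapply Rle_trans.
    - apply Series_Rabs.
      apply (ex_series_dominated _ (fun k => B (S J + k)%nat)); [|exact HBs].
      intros k; rewrite Rabs_Rabsolu; apply Hc.
    - apply Series_le; [|exact HBs].
      intros k; split; [apply Rabs_pos|apply Hc]. }
  pose proof (is_lim_seq_sum_n a l J (fun j _ => Hl j)) as Hs.
  apply is_lim_seq_spec in Hs.
  destruct (Hs (mkposreal _ He)) as [N0 HN0].
  exists N0. intros N HN.
  specialize (HN0 N HN). cbn [pos] in HN0.
  rewrite (Series_split_S (a N) J (Hexa N)), (Series_split_S l J Hexl).
  pose proof (Htail (a N) (Hb N)) as H1. pose proof (Htail l Hlb) as H2.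
  rewrite Rminus_0_r in HJ.
  pose proof (Rle_abs (Series (fun k => B (S J + k)%nat))) as H3.
  set (x := sum_n (a N) J) in *. set (y := sum_n l J) in *.
  set (u := Series (fun k => a N (S J + k)%nat)) in *.
  set (v := Series (fun k => l (S J + k)%nat)) in *.
  set (w := Series (fun k => B (S J + k)%nat)) in *.
  replace (x + u - (y + v)) with ((x - y) + (u - v)) by ring.
  apply Rle_lt_trans with (Rabs (x - y) + Rabs (u - v)); [apply Rabs_triang|].
  assert (Rabs (u - v) <= Rabs u + Rabs v)
    by (unfold Rminus; rewrite <- (Rabs_Ropp v); apply Rabs_triang).
  lra.
Qed.

Lemma Series_even_odd (u : nat -> R) :
  ex_series (fun n => Rabs (u n)) ->
  ex_series (fun n => u (2 * n)%nat) -> ex_series (fun n => u (S (2 * n))) ->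
  Series u = Series (fun n => u (2 * n)%nat) + Series (fun n => u (S (2 * n))).
Proof.
  intros H He Ho. apply ex_series_Rabs in H.
  assert (Hp : forall n, sum_n u (S (2 * n)) =
     sum_n (fun n => u (2 * n)%nat) n + sum_n (fun n => u (S (2 * n))) n).
  { induction n as [|n IH].
    - change (2 * 0)%nat with 0%nat. rewrite sum_Sn, !sum_O. reflexivity.
    - replace (S (2 * S n)) with (S (S (S (2 * n)))) by lia.
      rewrite (sum_Sn _ (S (S (2 * n)))), (sum_Sn _ (S (2 * n))), IH.
      rewrite !sum_Sn. replace (2 * S n)%nat with (S (S (2 * n))) by lia.
      unfold plus; simpl. ring. }
  assert (H1 : is_lim_seq (fun n => sum_n u (S (2 * n))) (Series u)).
  { apply (is_lim_seq_subseq (sum_n u) (Series u) (fun n => S (2 * n))).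
    - apply eventually_subseq. intros n; lia.
    - apply Series_correct in H. exact H. }
  assert (H2 : is_lim_seq (fun n => sum_n u (S (2 * n)))
     (Series (fun n => u (2 * n)%nat) + Series (fun n => u (S (2 * n))))).
  { apply (is_lim_seq_ext _ _ _ (fun n => eq_sym (Hp n))).
    apply is_lim_seq_plus'; [apply Series_correct in He; exact He|apply Series_correct in Ho; exact Ho]. }
  apply is_lim_seq_unique in H1. apply is_lim_seq_unique in H2.
  rewrite H1 in H2. injection H2; auto.
Qed.

(** * Complex power series with real coefficients *)

Definition abs_summable (u : nat -> C) : Prop := ex_series (fun n => Cmod (u n)).

Lemma im_le_Cmod (z : C) : Rabs (Im z) <= Cmod z.
Proof. eapply Rle_trans; [apply Rmax_r|apply Rmax_Cmod]. Qed.

Lemma ex_series_Re (u : nat -> C) : abs_summable u -> ex_series (fun n => Re (u n)).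
Proof. intros H. apply (ex_series_dominated _ _ (fun n => re_le_Cmod (u n)) H). Qed.

Lemma ex_series_Im (u : nat -> C) : abs_summable u -> ex_series (fun n => Im (u n)).
Proof. intros H. apply (ex_series_dominated _ _ (fun n => im_le_Cmod (u n)) H). Qed.

Lemma ex_series_Rscal (c : R) (a : nat -> R) :
  ex_series a -> ex_series (fun n => c * a n).
Proof. exact (ex_series_scal (K := R_AbsRing) (V := R_NormedModule) c a). Qed.

Lemma CSeries_ext (u v : nat -> C) : (forall n, u n = v n) -> CSeries u = CSeries v.
Proof.
  intros H. unfold CSeries. f_equal; apply Series_ext; intros n; now rewrite H.
Qed.

Lemma CSeries_plus (u v : nat -> C) : abs_summable u -> abs_summable v ->
  CSeries (fun n => (u n + v n)%C) = (CSeries u + CSeries v)%C.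
Proof.
  intros Hu Hv. unfold CSeries, Cplus; simpl. f_equal; rewrite <- Series_plus; auto;
    (apply ex_series_Re || apply ex_series_Im); auto.
Qed.

Lemma CSeries_scal (c : C) (u : nat -> C) : abs_summable u ->
  CSeries (fun n => (c * u n)%C) = (c * CSeries u)%C.
Proof.
  intros Hu. pose proof (ex_series_Re u Hu) as HR. pose proof (ex_series_Im u Hu) as HI.
  unfold CSeries, Cmult; simpl. f_equal.
  - rewrite Series_minus; [|now apply ex_series_Rscal..].
    rewrite !Series_scal_l. reflexivity.
  - rewrite Series_plus; [|now apply ex_series_Rscal..].
    rewrite !Series_scal_l. reflexivity.
Qed.

Lemma abs_summable_dominated (u : nat -> C) (B : nat -> R) :
  (forall n, Cmod (u n) <= B n) -> ex_series B -> abs_summable u.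
Proof.
  intros H HB. apply (ex_series_dominated _ B); auto.
  intros n. rewrite Rabs_pos_eq; [auto|apply Cmod_ge_0].
Qed.

Lemma abs_summable_scal (c : C) (u : nat -> C) :
  abs_summable u -> abs_summable (fun n => (c * u n)%C).
Proof.
  intros H. apply (abs_summable_dominated _ (fun n => Cmod c * Cmod (u n))).
  - intros n. rewrite Cmod_mult. apply Rle_refl.
  - now apply ex_series_Rscal.
Qed.

Lemma abs_summable_plus (u v : nat -> C) :
  abs_summable u -> abs_summable v -> abs_summable (fun n => (u n + v n)%C).
Proof.
  intros H H'. apply (abs_summable_dominated _ (fun n => Cmod (u n) + Cmod (v n))).
  - intros n. apply Cmod_triangle.
  - now apply (ex_series_plus (K := R_AbsRing) (V := R_NormedModule)).
Qed.

(** [CSeries] is defined componentwise.  Rotating the sum onto the positive axis turns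
    its modulus into a single real part, for which the real inequality applies. *)
Lemma Cmod_CSeries_le (u : nat -> C) : abs_summable u ->
  Cmod (CSeries u) <= Series (fun n => Cmod (u n)).
Proof.
  intros Hu. destruct (Ceq_dec (CSeries u) 0) as [E|E].
  - rewrite E, Cmod_0.
    replace 0 with (Series (fun n => 0 * Cmod (u n))) by (rewrite Series_scal_l; ring).
    apply Series_le; auto. intros n. pose proof (Cmod_ge_0 (u n)). lra.
  - pose proof (proj1 (Cmod_gt_0 _) E) as Hp.
    set (w := CSeries u) in *.
    (* The rotation that takes w to its modulus. *)
    set (e := (Cconj w / RtoC (Cmod w))%C).
    assert (He : Cmod e = 1).
    { unfold e. rewrite Cmod_div by (intros H; apply RtoC_inj in H; lra).
      rewrite Cmod_conj, Cmod_R, Rabs_pos_eq by lra. field; lra. }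
    assert (Hew : (e * w)%C = RtoC (Cmod w)).
    { unfold e. assert (HC : RtoC (Cmod w) <> 0) by (intros H; apply RtoC_inj in H; lra).
      replace (Cconj w / Cmod w * w)%C with ((w * Cconj w) / Cmod w)%C by (field; auto).
      rewrite <- Cmod2_conj, RtoC_pow. field; auto. }
    replace (Cmod w) with (Re (e * w)%C) by (rewrite Hew; reflexivity).
    unfold w at 1. rewrite <- CSeries_scal by auto.
    change (Re (CSeries (fun n => (e * u n)%C))) with (Series (fun n => Re (e * u n)%C)).
    clearbody e.
    eapply Rle_trans; [apply Rle_abs|].
    eapply Rle_trans; [apply Series_Rabs|].
    + apply (ex_series_dominated _ (fun n => Cmod (u n))); [|exact Hu].
      intros n. rewrite Rabs_Rabsolu.
      rewrite <- (Rmult_1_l (Cmod (u n))), <- He, <- Cmod_mult.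
      exact (re_le_Cmod (e * u n)%C).
    + apply Series_le; [|exact Hu]. intros n; split; [apply Rabs_pos|].
      rewrite <- (Rmult_1_l (Cmod (u n))), <- He, <- Cmod_mult.
      exact (re_le_Cmod (e * u n)%C).
Qed.

Lemma CSeries_even_odd (u : nat -> C) : abs_summable u ->
  abs_summable (fun n => u (2 * n)%nat) -> abs_summable (fun n => u (S (2 * n))) ->
  CSeries u = (CSeries (fun n => u (2 * n)%nat) + CSeries (fun n => u (S (2 * n))))%C.
Proof.
  intros H He Ho. unfold CSeries, Cplus; simpl.
  f_equal; apply Series_even_odd;
    try (now apply (ex_series_Re (fun n => u (2 * n)%nat)));
    try (now apply (ex_series_Im (fun n => u (2 * n)%nat)));
    try (now apply (ex_series_Re (fun n => u (S (2 * n)))));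
    try (now apply (ex_series_Im (fun n => u (S (2 * n)))));
    apply (ex_series_dominated _ (fun n => Cmod (u n))); auto; intros n; rewrite Rabs_Rabsolu.
  - apply re_le_Cmod.
  - apply im_le_Cmod.
Qed.

Lemma is_series_CSeries (u : nat -> C) : abs_summable u ->
  @is_series C_AbsRing C_NormedModule u (CSeries u).
Proof.
  intros H.
  pose proof (Series_correct _ (ex_series_Re u H)) as HR.
  pose proof (Series_correct _ (ex_series_Im u H)) as HI.
  assert (Hs : forall n, @sum_n C_NormedModule u n =
     (sum_n (fun k => Re (u k)) n, sum_n (fun k => Im (u k)) n)).
  { induction n as [|n IH].
    - rewrite !sum_O. destruct (u 0%nat); reflexivity.
    - rewrite !sum_Sn, IH. reflexivity. }
  unfold is_series. intros P [eps HP].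
  specialize (HR (ball (Series (fun n => Re (u n))) eps) (locally_ball _ _)).
  specialize (HI (ball (Series (fun n => Im (u n))) eps) (locally_ball _ _)).
  unfold filtermap in *.
  generalize (filter_and _ _ HR HI). apply filter_imp. intros n [H1 H2].
  apply HP. rewrite Hs. split; assumption.
Qed.

(** Power series with real coefficients at a complex argument.  Working with real
    coefficients makes the restriction to the real line a real power series. *)
Definition CPS (a : nat -> R) (z : C) : C := CSeries (fun n => (RtoC (a n) * z ^ n)%C).

Definition entire (a : nat -> R) : Prop := CV_radius a = p_infty.

Lemma entire_summable (a : nat -> R) (r : R) : entire a -> 0 <= r ->
  ex_series (fun n => Rabs (a n) * r ^ n).
Proof.
  intros H Hr. assert (Hl : Rbar_lt (Rabs r) (CV_radius a)) by (rewrite H; exact I).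
  eapply ex_series_ext; [|exact (CV_disk_inside a r Hl)].
  intros n. simpl. rewrite Rabs_mult, (Rabs_pos_eq (r ^ n)); auto. apply pow_le; auto.
Qed.

(** All coefficient sequences below are dominated by those of the exponential. *)
Lemma entire_of_le_inv_fact (a : nat -> R) :
  (forall n, Rabs (a n) <= / INR (fact n)) -> entire a.
Proof.
  intros H. unfold entire.
  destruct (CV_radius_bounded a) as [Hub _]. unfold is_ub_Rbar in Hub.
  assert (Hall : forall x, Rbar_le (Finite (Rabs x)) (CV_radius a)).
  { intros x. apply Hub. exists (exp (Rabs x)). intros n.
    rewrite Rabs_mult, (Rabs_pos_eq (Rabs x ^ n)) by (apply pow_le, Rabs_pos).
    apply Rle_trans with (/ INR (fact n) * Rabs x ^ n).
    - apply Rmult_le_compat_r; [apply pow_le, Rabs_pos|auto].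
    - pose proof (exp_ge_taylor (Rabs x) n (Rabs_pos x)) as He.
      eapply Rle_trans; [|exact He].
      assert (Hp : forall k, 0 <= Rabs x ^ k / INR (fact k)).
      { intros k. apply Rmult_le_pos; [apply pow_le, Rabs_pos|].
        left; apply Rinv_0_lt_compat, INR_fact_lt_0. }
      apply Rle_trans with (Rabs x ^ n / INR (fact n)); [right; unfold Rdiv; ring|].
      destruct n as [|n]; [apply Rle_refl|]. rewrite tech5.
      pose proof (cond_pos_sum (fun k => Rabs x ^ k / INR (fact k)) n Hp). lra. }
  destruct (CV_radius a) as [x| |]; auto.
  - specialize (Hall (Rabs x + 1)). simpl in Hall.
    pose proof (Rle_abs x). pose proof (Rabs_pos x). rewrite Rabs_pos_eq in Hall; lra.
  - specialize (Hall 0). simpl in Hall. contradiction.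
Qed.

Lemma Cmod_CPS_term (a : nat -> R) (z : C) (n : nat) :
  Cmod (RtoC (a n) * z ^ n)%C = Rabs (a n) * Cmod z ^ n.
Proof. now rewrite Cmod_mult, Cmod_R, Cmod_pow. Qed.

Lemma CPS_summable (a : nat -> R) (z : C) :
  entire a -> abs_summable (fun n => (RtoC (a n) * z ^ n)%C).
Proof.
  intros H. apply (abs_summable_dominated _ (fun n => Rabs (a n) * Cmod z ^ n)).
  - intros n. rewrite Cmod_CPS_term. apply Rle_refl.
  - apply entire_summable; auto. apply Cmod_ge_0.
Qed.

Lemma CPS_pseries (a : nat -> R) (z : C) : entire a ->
  @is_pseries C_AbsRing C_NormedModule (fun n => RtoC (a n)) z (CPS a z).
Proof.
  intros H. pose proof (is_series_CSeries _ (CPS_summable a z H)) as Hs.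
  unfold is_pseries. eapply is_series_ext; [|exact Hs].
  intros n. simpl. rewrite Cmult_comm. unfold scal; simpl.
  reflexivity.
Qed.

Lemma CPS_RtoC (a : nat -> R) (x : R) : CPS a (RtoC x) = RtoC (PSeries a x).
Proof.
  unfold CPS. rewrite (CSeries_ext _ (fun n => RtoC (a n * x ^ n))).
  - unfold CSeries, PSeries. simpl. apply injective_projections; simpl; [reflexivity|].
    transitivity (0 * Series (fun _ : nat => 0)); [|ring].
    rewrite <- Series_scal_l. apply Series_ext. intros n. simpl. ring.
  - intros n. rewrite <- RtoC_pow, <- RtoC_mult. reflexivity.
Qed.

(** The second-order Taylor remainder of a monomial is dominated by its value at
    z = r, h = 1, since all coefficients of the remainder are nonnegative. *)
Lemma Cpow_remainder (z h : C) (r : R) (n : nat) : Cmod z <= r -> Cmod h <= 1 ->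
  Cmod ((z + h) ^ n - z ^ n - RtoC (INR n) * z ^ pred n * h)%C <=
  Cmod h ^ 2 * ((r + 1) ^ n - r ^ n - INR n * r ^ pred n).
Proof.
  intros Hz Hh. pose proof (Cmod_ge_0 z) as Hz0. pose proof (Cmod_ge_0 h) as Hh0.
  induction n as [|n IH].
  - simpl. replace (1 - 1 - 0 * 1 * h)%C with (RtoC 0) by ring. rewrite Cmod_0. nra.
  - replace ((z + h) ^ S n - z ^ S n - RtoC (INR (S n)) * z ^ pred (S n) * h)%C
      with ((z + h) * ((z + h) ^ n - z ^ n - RtoC (INR n) * z ^ pred n * h)
            + RtoC (INR n) * z ^ pred n * h * h)%C.
    2:{ rewrite S_INR, RtoC_plus. destruct n as [|n]; simpl pred; rewrite !Cpow_S; simpl INR; ring. }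
    eapply Rle_trans; [apply Cmod_triangle|].
    assert (Hn : INR n * r ^ n <= INR n * r ^ n) by lra.
    rewrite !Cmod_mult, Cmod_R, Cmod_pow, (Rabs_pos_eq (INR n)) by apply pos_INR.
    pose proof (pow_le r (pred n) ltac:(lra)) as Hp.
    pose proof (pow_incr (Cmod z) r (pred n) (conj Hz0 Hz)) as Hi.
    pose proof (pos_INR n) as Hn0.
    pose proof (Cmod_triangle z h) as Ht.
    pose proof (Cmod_ge_0 (z + h)%C) as Hzh.
    pose proof (Cmod_ge_0 ((z + h) ^ n - z ^ n - RtoC (INR n) * z ^ pred n * h)%C) as Hc.
    set (c := Cmod _) in *.
    apply Rle_trans with ((r + 1) * (Cmod h ^ 2 * ((r + 1) ^ n - r ^ n - INR n * r ^ pred n))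
        + INR n * r ^ pred n * Cmod h * Cmod h).
    + apply Rplus_le_compat.
      * apply Rmult_le_compat; lra.
      * apply Rmult_le_compat_r; [lra|]. apply Rmult_le_compat_r; [lra|].
        apply Rmult_le_compat_l; lra.
    + rewrite S_INR. simpl pred.
      assert (E : r * (INR n * r ^ pred n) = INR n * r ^ n) by (destruct n; simpl; ring).
      apply Req_le.
      transitivity (Cmod h ^ 2 * ((r + 1) * (r + 1) ^ n - r * r ^ n - r ^ n
         - (r * (INR n * r ^ pred n)))); [ring|].
      rewrite E. simpl. ring.
Qed.

Lemma CPS_derive_reindex (a : nat -> R) (z : C) : entire a ->
  abs_summable (fun n => (RtoC (a n) * (RtoC (INR n) * z ^ pred n))%C) /\
  CSeries (fun n => (RtoC (a n) * (RtoC (INR n) * z ^ pred n))%C) = CPS (PS_derive a) z.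
Proof.
  intros H.
  assert (H' : entire (PS_derive a)) by (unfold entire; now rewrite CV_radius_derive).
  assert (HS : forall n, (RtoC (a (S n)) * (RtoC (INR (S n)) * z ^ pred (S n)))%C
     = (RtoC (PS_derive a n) * z ^ n)%C).
  { intros n. unfold PS_derive. rewrite RtoC_mult. simpl pred. ring. }
  split.
  - unfold abs_summable. rewrite ex_series_incr_1.
    eapply ex_series_ext; [|exact (CPS_summable _ z H')].
    intros n. simpl. f_equal. symmetry. exact (HS n).
  - unfold CPS. rewrite <- (CSeries_ext _ _ HS).
    unfold CSeries. f_equal; rewrite Series_incr_1_aux; auto; simpl; ring.
Qed.

Lemma CPS_remainder (a : nat -> R) (z : C) : entire a ->
  exists K, forall h : C, Cmod h <= 1 ->
    Cmod (CPS a (z + h) - CPS a z - h * CPS (PS_derive a) z)%C <= K * Cmod h ^ 2.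
Proof.
  intros H. set (r := Cmod z).
  pose proof (Cmod_ge_0 z) as Hr. fold r in Hr.
  set (B := fun n => Rabs (a n) * ((r + 1) ^ n - r ^ n - INR n * r ^ pred n)).
  assert (HB : ex_series B).
  { destruct (CPS_derive_reindex a (RtoC r) H) as [H3 _].
    pose proof (entire_summable a (r + 1) H ltac:(lra)) as H1.
    pose proof (entire_summable a r H Hr) as H2.
    pose proof (ex_series_minus _ _ (ex_series_minus _ _ H1 H2) H3) as H4.
    eapply ex_series_ext; [|exact H4]. intros n. unfold B.
    rewrite !Cmod_mult, !Cmod_R, Cmod_pow, Cmod_R, (Rabs_pos_eq (INR n)), (Rabs_pos_eq r)
      by (try apply pos_INR; auto).
    unfold minus, plus, opp; simpl. ring. }
  exists (Series B). intros h Hh.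
  destruct (CPS_derive_reindex a z H) as [Hs <-].
  unfold CPS.
  pose proof (CPS_summable a (z + h) H) as S1.
  pose proof (CPS_summable a z H) as S2.
  replace (CSeries (fun n => RtoC (a n) * (z + h) ^ n) - CSeries (fun n => RtoC (a n) * z ^ n)
     - h * CSeries (fun n => RtoC (a n) * (RtoC (INR n) * z ^ pred n)))%C
   with (CSeries (fun n => RtoC (a n) * (z + h) ^ n) + (- (1)) * CSeries (fun n => RtoC (a n) * z ^ n)
     + (- h) * CSeries (fun n => RtoC (a n) * (RtoC (INR n) * z ^ pred n)))%C by ring.
  rewrite <- !CSeries_scal, <- CSeries_plus, <- CSeries_plus
    by (repeat first [assumption | apply abs_summable_plus | apply abs_summable_scal]).
  eapply Rle_trans; [apply Cmod_CSeries_le;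
     repeat first [assumption | apply abs_summable_plus | apply abs_summable_scal]|].
  rewrite Rmult_comm, <- Series_scal_l.
  apply Series_le; [|now apply ex_series_Rscal].
  intros n. split; [apply Cmod_ge_0|].
  replace (RtoC (a n) * (z + h) ^ n + - (1) * (RtoC (a n) * z ^ n)
     + - h * (RtoC (a n) * (RtoC (INR n) * z ^ pred n)))%C
    with (RtoC (a n) * ((z + h) ^ n - z ^ n - RtoC (INR n) * z ^ pred n * h))%C by ring.
  rewrite Cmod_mult, Cmod_R. unfold B.
  pose proof (Cpow_remainder z h r n (Rle_refl _) Hh).
  rewrite (Rmult_comm (Cmod h ^ 2)), Rmult_assoc. apply Rmult_le_compat_l; [apply Rabs_pos|].
  lra.
Qed.

(** [C_derive] takes a limit along real increments only, so a quadratic error bound for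
    real [h] is enough. *)
Lemma C_derive_intro (f : C -> C) (z l : C) (K : R) :
  (forall h : R, Rabs h <= 1 ->
     Cmod (f (z + RtoC h) - f z - RtoC h * l)%C <= K * Rabs h ^ 2) ->
  C_derive f z = l.
Proof.
  intros H.
  assert (Hq : forall h : R, h <> 0 -> Rabs h <= 1 ->
     Cmod ((f (z + RtoC h) - f z) / RtoC h - l)%C <= K * Rabs h).
  { intros h Hh0 Hh1. specialize (H h Hh1).
    assert (HC : RtoC h <> 0) by (intros E; apply RtoC_inj in E; auto).
    pose proof (Rabs_pos_lt h Hh0) as Hp.
    replace ((f (z + RtoC h) - f z) / RtoC h - l)%C
      with ((f (z + RtoC h) - f z - RtoC h * l) / RtoC h)%C by (field; auto).
    rewrite Cmod_div, Cmod_R by auto.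
    apply Rmult_le_reg_r with (Rabs h); auto.
    unfold Rdiv. rewrite Rmult_assoc, Rinv_l, Rmult_1_r by lra. simpl in H. lra. }
  destruct z as [zx zy]. 
  assert (E : forall x, x <> zx ->
     ((f (x, zy) - f (zx, zy)) / ((x, zy) - (zx, zy)))%C
     = ((f ((zx, zy) + RtoC (x - zx)) - f (zx, zy)) / RtoC (x - zx))%C).
  { intros x _. f_equal; [|f_equal]; [f_equal; f_equal|].
    - unfold Cplus, RtoC; simpl. f_equal; ring.
    - unfold Cminus, Cplus, Copp, RtoC; simpl. f_equal; ring. }
  assert (Hlim : forall p : C -> R, (forall u v, p (u - v)%C = p u - p v) ->
     (forall u, Rabs (p u) <= Cmod u) ->
     is_lim (fun x => p ((f (x, zy) - f (zx, zy)) / ((x, zy) - (zx, zy)))%C) zx (p l)).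
  { intros p Hpm Hpc. apply is_lim_spec. intros eps.
    assert (HK : 0 < Rabs K + 1) by (pose proof (Rabs_pos K); lra).
    assert (Hd : 0 < Rmin 1 (eps / (Rabs K + 1))).
    { apply Rmin_pos; [lra|]. apply Rdiv_lt_0_compat; [apply cond_pos|auto]. }
    exists (mkposreal _ Hd). intros x Hx Hne. unfold ball in Hx; simpl in Hx.
    unfold AbsRing_ball, abs, minus, plus, opp in Hx; simpl in Hx.
    change (x + - zx) with (x - zx) in Hx.
    pose proof (Rmin_l 1 (eps / (Rabs K + 1))). pose proof (Rmin_r 1 (eps / (Rabs K + 1))).
    rewrite E by auto. rewrite <- Hpm.
    eapply Rle_lt_trans; [apply Hpc|].
    eapply Rle_lt_trans; [apply Hq; [lra|lra]|].
    pose proof (Rle_abs K). pose proof (Rabs_pos (x - zx)).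
    apply Rle_lt_trans with ((Rabs K + 1) * Rabs (x - zx)); [nra|].
    apply Rmult_lt_reg_r with (/ (Rabs K + 1)); [now apply Rinv_0_lt_compat|].
    replace ((Rabs K + 1) * Rabs (x - zx) * / (Rabs K + 1)) with (Rabs (x - zx)) by (field; lra).
    unfold Rdiv in *. lra. }
  unfold C_derive, C_lim. change (snd (zx, zy)) with zy. change (fst (zx, zy)) with zx.
  rewrite (is_lim_unique _ _ _ (Hlim fst (fun u v => eq_refl) re_le_Cmod)).
  rewrite (is_lim_unique _ _ _ (Hlim snd (fun u v => eq_refl) im_le_Cmod)).
  destruct l; reflexivity.
Qed.

Lemma C_derive_CPS (a : nat -> R) (z : C) : entire a ->
  C_derive (CPS a) z = CPS (PS_derive a) z.
Proof.
  intros H. destruct (CPS_remainder a z H) as [K HK].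
  apply (C_derive_intro _ _ _ K). intros h Hh.
  rewrite <- Cmod_R. apply HK. now rewrite Cmod_R.
Qed.

Lemma C_derive_ext (f g : C -> C) (z : C) :
  (forall w, f w = g w) -> C_derive f z = C_derive g z.
Proof.
  intros H. unfold C_derive, C_lim. f_equal; f_equal; apply Lim_ext; intros x; now rewrite !H.
Qed.
(** The increments in [C_derive] being real, only the values of [f] on the real line
    matter at a real point. *)
Lemma C_derive_real (f : C -> C) (phi : R -> R) (x l : R) :
  locally x (fun t => f (RtoC t) = RtoC (phi t)) -> is_derive phi x l ->
  C_derive f (RtoC x) = RtoC l.
Proof.
  intros Hf Hd.
  assert (Hx : f (RtoC x) = RtoC (phi x)) by (exact (locally_singleton x _ Hf)).
  assert (Hq : forall t, f (RtoC t) = RtoC (phi t) -> t <> x ->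
     ((f (RtoC t) - f (RtoC x)) / (RtoC t - RtoC x))%C = RtoC ((phi t - phi x) / (t - x))).
  { intros t Ht Hne. rewrite Ht, Hx, <- !RtoC_minus, RtoC_div; auto. lra. }
  assert (Hloc : locally' x (fun t => 
     ((f (RtoC t) - f (RtoC x)) / (RtoC t - RtoC x))%C = RtoC ((phi t - phi x) / (t - x)))).
  { unfold locally', within. revert Hf. apply filter_imp. auto. }
  assert (Hlim : is_lim (fun t => (phi t - phi x) / (t - x)) x l).
  { apply is_lim_spec. intros eps. apply is_derive_Reals in Hd.
    destruct (Hd eps (cond_pos eps)) as [d Hd']. exists d. intros t Ht Hne.
    specialize (Hd' (t - x) ltac:(lra) Ht).
    now rewrite Rplus_minus in Hd'. }
  unfold C_derive, C_lim. change (snd (RtoC x)) with 0. change (fst (RtoC x)) with x.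
  apply injective_projections; cbn [fst snd RtoC].
  - rewrite (is_lim_unique _ _ l); [reflexivity|].
    revert Hlim. apply is_lim_ext_loc. revert Hloc. apply filter_imp. intros t Ht.
    change (t, 0) with (RtoC t). change (x, 0) with (RtoC x). now rewrite Ht.
  - rewrite (is_lim_unique _ _ 0); [reflexivity|].
    apply (is_lim_ext_loc (fun _ => 0)); [|apply is_lim_const].
    revert Hloc. apply filter_imp. intros t Ht.
    change (t, 0) with (RtoC t). change (x, 0) with (RtoC x). now rewrite Ht.
Qed.

(** * Polynomials with positive zeros *)

Fixpoint peval (l : list R) (z : C) : C :=
  match l with
  | nil => 0
  | a :: l' => (RtoC a + z * peval l' z)%C
  end.

(** The polynomial z p'(z), for which synthetic division stays a polynomial identity. *)
Fixpoint euler_peval (l : list R) (z : C) : C :=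
  match l with
  | nil => 0
  | a :: l' => (z * (peval l' z + euler_peval l' z))%C
  end.

Lemma peval_real (l : list R) (x : R) : peval l (RtoC x) = RtoC (Re (peval l (RtoC x))).
Proof.
  induction l as [|a l IH]; [reflexivity|]. simpl peval. rewrite IH.
  rewrite <- RtoC_mult, <- RtoC_plus. reflexivity.
Qed.

(** Division by z - t, with the companion identity for z d/dz that the product rule
    gives; keeping both avoids differentiating later. *)
Lemma synthetic_division (t : R) (l : list R) :
  exists q, length q = pred (length l) /\ forall z,
    peval l z = ((z - RtoC t) * peval q z + peval l (RtoC t))%C /\
    euler_peval l z = (z * peval q z + (z - RtoC t) * euler_peval q z)%C.
Proof.
  induction l as [|a l [q [Hq H]]].
  - exists nil. split; [reflexivity|]. intros z; simpl; split; ring.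
  - destruct l as [|b l'].
    + exists nil. split; [reflexivity|]. intros z; simpl; split; ring.
    + remember (b :: l') as l eqn:El.
      exists (Re (peval l (RtoC t)) :: q). split.
      * simpl. rewrite Hq, El. reflexivity.
      * intros z. destruct (H z) as [H1 H2]. simpl. rewrite <- peval_real, H1, H2.
        split; ring.
Qed.

Fixpoint zero_product (ts : list R) (z : C) : C :=
  match ts with
  | nil => 1
  | t :: ts' => ((1 - z / RtoC t) * zero_product ts' z)%C
  end.

Fixpoint euler_zero_product (ts : list R) (z : C) : C :=
  match ts with
  | nil => 0
  | t :: ts' => (- (z / RtoC t) * zero_product ts' z
                 + (1 - z / RtoC t) * euler_zero_product ts' z)%C
  end.

Lemma peval_factor (ts : list R) (l : list R) :
  NoDup ts -> length l = S (length ts) ->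
  (forall t, In t ts -> t <> 0 /\ peval l (RtoC t) = 0) ->
  forall z, peval l z = (peval l 0 * zero_product ts z)%C /\
            euler_peval l z = (peval l 0 * euler_zero_product ts z)%C.
Proof.
  revert l. induction ts as [|t ts IH]; intros l Hnd Hlen Hr z.
  - destruct l as [|a [|b l]]; try discriminate. simpl. split; ring.
  - destruct (synthetic_division t l) as [q [Hq H]].
    destruct (Hr t (or_introl eq_refl)) as [Ht0 Ht].
    assert (HtC : RtoC t <> 0) by (intros E; apply RtoC_inj in E; auto).
    inversion Hnd as [|t' ts' Hni Hnd' E1]; subst.
    assert (Hq' : forall u, In u ts -> u <> 0 /\ peval q (RtoC u) = 0).
    { intros u Hu. destruct (Hr u (or_intror Hu)) as [Hu0 Hu1]. split; auto.
      destruct (H (RtoC u)) as [H1 _]. rewrite Ht, Hu1 in H1.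
      assert (Hne : (RtoC u - RtoC t)%C <> 0).
      { rewrite <- RtoC_minus. intros E. apply RtoC_inj in E.
        apply Hni. now replace t with u by lra. }
      destruct (Ceq_dec (peval q (RtoC u)) 0) as [E|E]; auto.
      exfalso. apply (Cmult_neq_0 _ _ Hne E).
      transitivity (((RtoC u - RtoC t) * peval q (RtoC u) + 0)%C); [ring|now rewrite <- H1]. }
    destruct (IH q Hnd' ltac:(rewrite Hq, Hlen; reflexivity) Hq' z) as [I1 I2].
    destruct (H z) as [H1 H2]. destruct (H 0) as [H3 _].
    rewrite H1, H2, H3, Ht, I1, I2. simpl. split; field; auto.
Qed.

Lemma Cmod_one_minus (z : C) (t r : R) : Cmod z <= r -> r < t ->
  1 - r / t <= Cmod (1 - z / RtoC t)%C /\ 0 < 1 - r / t /\ Cmod (z / RtoC t)%C <= r / t.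
Proof.
  intros Hz Hr. pose proof (Cmod_ge_0 z).
  assert (HtC : RtoC t <> 0) by (intros E; apply RtoC_inj in E; lra).
  assert (Hi : 0 < / t) by (apply Rinv_0_lt_compat; lra).
  assert (E : Cmod (z / RtoC t)%C <= r / t).
  { rewrite Cmod_div, Cmod_R, Rabs_pos_eq by (auto; lra).
    apply Rmult_le_compat_r; lra. }
  split; [|split]; auto.
  - pose proof (Cmod_triangle (1 - z / RtoC t)%C (z / RtoC t)%C) as Ht.
    replace (1 - z / RtoC t + z / RtoC t)%C with (RtoC 1) in Ht by ring.
    rewrite Cmod_1 in Ht. lra.
  - assert (r / t < 1); [|lra]. apply Rmult_lt_reg_r with t; [lra|].
    unfold Rdiv. rewrite Rmult_assoc, Rinv_l; lra.
Qed.

(** Each factor satisfies |1 - z/t| >= 1 - r/t and |z/t| <= r/t.  The bound on the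
    logarithmic derivative is kept free of divisions, so that it can be passed to limits. *)
Lemma zero_product_bounds (ts : list R) (r : R) (z : C) :
  Cmod z <= r -> (forall t, In t ts -> r < t) ->
  exists p d, zero_product ts (RtoC r) = RtoC p /\ euler_zero_product ts (RtoC r) = RtoC d /\
    0 < p /\ d <= 0 /\ p <= Cmod (zero_product ts z) /\
    Cmod (euler_zero_product ts z) * p <= - d * Cmod (zero_product ts z).
Proof.
  intros Hz. pose proof (Cmod_ge_0 z). induction ts as [|t ts IH]; intros Hts.
  - exists 1, 0. simpl. rewrite Cmod_0, Cmod_1. repeat split; lra.
  - destruct IH as [p [d [Hp [Hd [Hp0 [Hd0 [Hpz Hdz]]]]]]]; [intros; apply Hts; now right|].
    assert (Hrt : r < t) by (apply Hts; now left).
    assert (HtC : RtoC t <> 0) by (intros E; apply RtoC_inj in E; lra).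
    destruct (Cmod_one_minus z t r Hz Hrt) as [F1 [F2 F3]].
    exists ((1 - r / t) * p), (- (r / t) * p + (1 - r / t) * d).
    assert (Hr0 : 0 <= r / t) by (pose proof (Cmod_ge_0 (z / RtoC t)%C); lra).
    simpl. rewrite Hp, Hd. repeat split.
    + rewrite RtoC_mult, RtoC_minus, RtoC_div by lra. reflexivity.
    + rewrite RtoC_plus, !RtoC_mult, RtoC_opp, RtoC_minus, RtoC_div by lra. reflexivity.
    + now apply Rmult_lt_0_compat.
    + nra.
    + rewrite Cmod_mult. apply Rmult_le_compat; lra.
    + rewrite Cmod_mult.
      set (f := Cmod (1 - z / RtoC t)%C) in *. set (P := Cmod (zero_product ts z)) in *.
      set (D := Cmod (euler_zero_product ts z)) in *.
      assert (Ht : Cmod (- (z / RtoC t) * zero_product ts z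
          + (1 - z / RtoC t) * euler_zero_product ts z)%C <= r / t * P + f * D).
      { eapply Rle_trans; [apply Cmod_triangle|]. rewrite !Cmod_mult, Cmod_opp.
        fold f P D. apply Rplus_le_compat_r. apply Rmult_le_compat_r; auto. apply Cmod_ge_0. }
      assert (HD : 0 <= D) by apply Cmod_ge_0.
      assert (HP : 0 <= P) by lra.
      assert (Hq : 0 < (1 - r / t) * p) by now apply Rmult_lt_0_compat.
      apply Rle_trans with ((r / t * P + f * D) * ((1 - r / t) * p)).
      * apply Rmult_le_compat_r; lra.
      * assert (A1 : r / t * P * p * (1 - r / t) <= r / t * P * p * f).
        { apply Rmult_le_compat_l; auto. apply Rmult_le_pos; [|lra]. now apply Rmult_le_pos. }
        assert (A2 : (f * (1 - r / t)) * (D * p) <= (f * (1 - r / t)) * (- d * P)).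
        { apply Rmult_le_compat_l; auto. apply Rmult_le_pos; lra. }
        nra.
Qed.

(** A root in the disc would be a zero on the segment [0, r]: positivity of the roots
    reduces the hypothesis of [zero_product_bounds] to the real line. *)
Lemma real_rooted_bounds (l ts : list R) (r : R) (z : C) :
  NoDup ts -> length l = S (length ts) -> peval l 0 = 1 ->
  (forall t, In t ts -> 0 < t /\ peval l (RtoC t) = 0) ->
  (forall x, 0 <= x <= r -> peval l (RtoC x) <> 0) -> Cmod z <= r ->
  Cmod (euler_peval l z) * Re (peval l (RtoC r))
    <= - Re (euler_peval l (RtoC r)) * Cmod (peval l z) /\
  Re (peval l (RtoC r)) <= Cmod (peval l z).
Proof.
  intros Hnd Hlen H0 Hts Hpos Hz.
  assert (Hf := peval_factor ts l Hnd Hlen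
    ltac:(intros t Ht; destruct (Hts t Ht); split; [lra|auto])).
  assert (Hbig : forall t, In t ts -> r < t).
  { intros t Ht. destruct (Hts t Ht) as [Ht0 Ht1]. destruct (Rlt_le_dec r t); auto.
    exfalso. apply (Hpos t); auto; lra. }
  destruct (zero_product_bounds ts r z Hz Hbig) as [p [d [Hp [Hd [Hp0 [Hd0 [Hpz Hdz]]]]]]].
  destruct (Hf z) as [-> ->]. destruct (Hf (RtoC r)) as [-> ->].
  rewrite H0, Hp, Hd, !Cmult_1_l. simpl. split; lra.
Qed.

Lemma CSeries_finite (u : nat -> C) (n : nat) :
  (forall k, (n <= k)%nat -> u k = 0) -> abs_summable u.
Proof.
  intros H. unfold abs_summable. apply (ex_series_incr_n (fun k => Cmod (u k)) n).
  apply (ex_series_ext (fun _ => 0)).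
  - intros k. rewrite H by lia. now rewrite Cmod_0.
  - exists 0. apply is_series_Reals. intros e He. exists 0%nat. intros m _.
    rewrite sum_eq_R0 by auto. now rewrite R_dist_eq.
Qed.

Lemma CSeries_S (u : nat -> C) : abs_summable u ->
  CSeries u = (u 0%nat + CSeries (fun n => u (S n)))%C.
Proof.
  intros H. unfold CSeries. apply injective_projections; simpl.
  - apply Series_incr_1, (ex_series_Re u H).
  - apply Series_incr_1, (ex_series_Im u H).
Qed.

Lemma peval_CPS (a : nat -> R) (N k : nat) (z : C) :
  (forall n, (k + N <= n)%nat -> a n = 0) ->
  (z ^ k * peval (map a (seq k N)) z)%C = CSeries (fun n => (RtoC (a (k + n)%nat) * z ^ (k + n))%C) /\
  (z ^ k * (RtoC (INR k) * peval (map a (seq k N)) z + euler_peval (map a (seq k N)) z))%C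
    = CSeries (fun n => (RtoC (INR (k + n) * a (k + n)%nat) * z ^ (k + n))%C).
Proof.
  revert k. induction N as [|N IH]; intros k H.
  - assert (E : forall f : nat -> R, (forall n, f n = 0) ->
       CSeries (fun n => (RtoC (f n) * z ^ (k + n))%C) = 0).
    { intros f Hf. rewrite (CSeries_ext _ (fun _ => (0 * 0)%C)).
      - rewrite CSeries_scal; [ring|]. apply (CSeries_finite _ 0). auto.
      - intros n. rewrite Hf. ring. }
    rewrite !E; [simpl; split; ring|..].
    + intros n. rewrite H by lia. ring.
    + intros n. apply H; lia.
  - destruct (IH (S k)) as [I1 I2]; [intros n Hn; apply H; lia|].
    rewrite CSeries_S, (CSeries_S (fun n => (RtoC (INR (k + n) * _) * _)%C)).
    + rewrite (CSeries_ext _ (fun n => (RtoC (a (S k + n)%nat) * z ^ (S k + n))%C))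
        by (intros n; replace (k + S n)%nat with (S k + n)%nat by lia; reflexivity).
      rewrite (CSeries_ext (fun n => (RtoC (INR (k + S n) * _) * _)%C)
          (fun n => (RtoC (INR (S k + n) * a (S k + n)%nat) * z ^ (S k + n))%C))
        by (intros n; replace (k + S n)%nat with (S k + n)%nat by lia; reflexivity).
      rewrite <- I1, <- I2. replace (k + 0)%nat with k by lia.
      simpl seq. simpl map. simpl peval. simpl euler_peval.
      rewrite RtoC_mult, S_INR, RtoC_plus, Cpow_S. split; ring.
    + apply (CSeries_finite _ (S N)). intros n Hn. rewrite H by lia. rewrite Rmult_0_r. ring.
    + apply (CSeries_finite _ (S N)). intros n Hn. rewrite H by lia. ring.
Qed.

(** * Central factorials and increasing cosine sums *)

Fixpoint central_factorial (j : nat) (x : R) : R :=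
  match j with
  | O => 1
  | S i => central_factorial i x * (x ^ 2 - INR i ^ 2)
  end.

(** The common factor of [central_factorial (S j)] at x and at x - 1. *)
Fixpoint half_factorial (j : nat) (x : R) : R :=
  match j with
  | O => 1
  | S i => half_factorial i x * ((x - INR j) * (x + INR i))
  end.

Lemma central_factorial_half (j : nat) (x : R) :
  central_factorial (S j) (x + 1) = half_factorial j (x + 1) * ((x + 1) * (x + 1 + INR j)) /\
  central_factorial (S j) x = half_factorial j (x + 1) * (x * (x - INR j)).
Proof.
  induction j as [|j [I1 I2]].
  - simpl. split; ring.
  - change (central_factorial (S (S j)) ?y)
      with (central_factorial (S j) y * (y ^ 2 - INR (S j) ^ 2)).
    rewrite I1, I2. cbn [half_factorial]. rewrite S_INR. split; ring.
Qed.

(** The common factor of [central_factorial (S (S j))] at x - 1, x and x + 1. *)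
Fixpoint punctured_factorial (j : nat) (x : R) : R :=
  match j with
  | O => 1
  | S i => punctured_factorial i x * (x ^ 2 - INR j ^ 2)
  end.

Lemma central_factorial_punctured (j : nat) (x : R) :
  central_factorial (S j) x = x ^ 2 * punctured_factorial j x.
Proof.
  induction j as [|j IH]; [simpl; ring|].
  change (central_factorial (S (S j)) x) with (central_factorial (S j) x * (x ^ 2 - INR (S j) ^ 2)).
  rewrite IH. cbn [punctured_factorial]. ring.
Qed.

Lemma central_factorial_shift (j : nat) (x : R) :
  central_factorial (S (S j)) (x + 1)
    = x * (x + 1) * punctured_factorial j x * (x + INR j + 1) * (x + INR j + 2) /\
  central_factorial (S (S j)) (x - 1)
    = x * (x - 1) * punctured_factorial j x * (x - INR j - 1) * (x - INR j - 2).
Proof.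
  induction j as [|j [I1 I2]].
  - simpl. split; ring.
  - change (central_factorial (S (S (S j))) ?y)
      with (central_factorial (S (S j)) y * (y ^ 2 - INR (S (S j)) ^ 2)).
    rewrite I1, I2. cbn [punctured_factorial]. rewrite !S_INR. split; ring.
Qed.

Lemma central_factorial_second_difference (j : nat) (x : R) :
  central_factorial (S j) (x + 1) + central_factorial (S j) (x - 1)
    - 2 * central_factorial (S j) x
  = 2 * (INR j + 1) * (2 * INR j + 1) * central_factorial j x.
Proof.
  destruct j as [|j]; [simpl; ring|].
  destruct (central_factorial_shift j x) as [-> ->].
  rewrite !central_factorial_punctured. cbn [punctured_factorial]. rewrite !S_INR. ring.
Qed.

Lemma central_factorial_zero (j k : nat) : (k < j)%nat -> central_factorial j (INR k) = 0.
Proof.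
  induction j as [|j IH]; intros H; [lia|]. simpl.
  destruct (Nat.eq_dec k j) as [->|Hne]; [ring|]. rewrite IH by lia. ring.
Qed.

Definition chebyshev_coef (j : nat) : R := (- 4) ^ j / INR (fact (2 * j)).

Lemma chebyshev_coef_S (j : nat) :
  chebyshev_coef (S j) * (2 * (INR j + 1) * (2 * INR j + 1)) = - 4 * chebyshev_coef j.
Proof.
  unfold chebyshev_coef. replace (2 * S j)%nat with (S (S (2 * j))) by lia.
  rewrite !fact_simpl, !mult_INR, !S_INR, mult_INR. simpl (INR 2).
  pose proof (INR_fact_neq_0 (2 * j)). pose proof (pos_INR j).
  simpl pow. field. repeat split; auto; lra.
Qed.

(** The Chebyshev polynomial T_k(1 - 2x), whose coefficients are central factorials of k.
    Being explicit in k, the formula lets a sum over k act on the coefficients. *)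
Definition chebyshev_sum (J : nat) (k x : R) : R :=
  sum_n (fun j => chebyshev_coef j * central_factorial j k * x ^ j) J.

Lemma chebyshev_recurrence (J : nat) (k x : R) :
  chebyshev_sum (S J) (k + 1) x + chebyshev_sum (S J) (k - 1) x - 2 * chebyshev_sum (S J) k x = - 4 * x * chebyshev_sum J k x.
Proof.
  assert (Hstep : forall j,
    chebyshev_coef (S j) * central_factorial (S j) (k + 1) * x ^ S j
    + chebyshev_coef (S j) * central_factorial (S j) (k - 1) * x ^ S j
    - 2 * (chebyshev_coef (S j) * central_factorial (S j) k * x ^ S j)
    = - 4 * x * (chebyshev_coef j * central_factorial j k * x ^ j)).
  { intros j.
    transitivity (chebyshev_coef (S j) * x ^ S j * (central_factorial (S j) (k + 1)
       + central_factorial (S j) (k - 1) - 2 * central_factorial (S j) k)); [ring|].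
    rewrite central_factorial_second_difference.
    transitivity ((chebyshev_coef (S j) * (2 * (INR j + 1) * (2 * INR j + 1)))
       * (x ^ S j * central_factorial j k)); [ring|].
    rewrite chebyshev_coef_S. simpl. ring. }
  assert (Hsum : forall A B D E : nat -> R, A 0%nat + B 0%nat - 2 * D 0%nat = 0 ->
    (forall j, A (S j) + B (S j) - 2 * D (S j) = - 4 * x * E j) ->
    sum_n A (S J) + sum_n B (S J) - 2 * sum_n D (S J) = - 4 * x * sum_n E J).
  { clear. intros A B D E H0 HS. induction J as [|J IH].
    - rewrite !sum_n_succ, !sum_n_zero. 
      specialize (HS 0%nat). lra.
    - rewrite (sum_n_succ A (S J)), (sum_n_succ B (S J)), (sum_n_succ D (S J)), (sum_n_succ E J).
       specialize (HS (S J)). lra. }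
  apply Hsum; [simpl; ring|exact Hstep].
Qed.

(** Both sides satisfy the three-term recurrence of the cosine.  The bound k <= J is what
    makes the truncation of the sum at J harmless. *)
Lemma chebyshev_cos (J k : nat) (t : R) : (k <= J)%nat ->
  chebyshev_sum J (INR k) (sin (t / 2) ^ 2) = cos (INR k * t).
Proof.
  intros Hk. set (x := sin (t / 2) ^ 2).
  assert (Hx : 1 - 2 * x = cos t).
  { replace t with (2 * (t / 2)) by field. rewrite cos_2a_sin. unfold x.
    replace (2 * (t / 2)) with t by field. ring. }
  assert (H0 : forall J, chebyshev_sum J 0 x = 1).
  { intros J'. unfold chebyshev_sum. induction J' as [|J' IH].
    - rewrite sum_n_zero. unfold chebyshev_coef. simpl. field.
    - rewrite sum_n_succ, IH. change 0 with (INR 0) at 1. rewrite central_factorial_zero by lia.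
      simpl. ring. }
  assert (H1 : forall J, chebyshev_sum (S J) 1 x = cos t).
  { intros J'. unfold chebyshev_sum. induction J' as [|J' IH].
    - rewrite sum_n_succ, sum_n_zero, <- Hx. unfold chebyshev_coef. simpl. field.
    - rewrite sum_n_succ, IH. change 1 with (INR 1) at 1. rewrite central_factorial_zero by lia.
      simpl. ring. }
  destruct J as [|J].
  { replace k with 0%nat by lia. simpl INR. rewrite H0, Rmult_0_l, cos_0. reflexivity. }
  assert (Hboth : forall n, (n <= J)%nat ->
    chebyshev_sum (S J) (INR n) x = cos (INR n * t) /\ chebyshev_sum (S J) (INR (S n)) x = cos (INR (S n) * t)).
  { induction n as [|n IH]; intros Hn.
    - simpl INR. rewrite H0, H1, Rmult_0_l, Rmult_1_l, cos_0. auto.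
    - destruct (IH ltac:(lia)) as [I1 I2]. split; auto.
      pose proof (chebyshev_recurrence J (INR (S n)) x) as Hr.
      rewrite (S_INR (S n)).
      replace (INR (S n) - 1) with (INR n) in Hr by (rewrite S_INR; ring).
      assert (E : chebyshev_sum J (INR (S n)) x = chebyshev_sum (S J) (INR (S n)) x).
      { unfold chebyshev_sum. rewrite sum_n_succ, (central_factorial_zero (S J)) by lia.
        rewrite Rmult_0_r, Rmult_0_l, Rplus_0_r. reflexivity. }
      rewrite E, I1, I2 in Hr.
      assert (C : cos ((INR (S n) + 1) * t) = 2 * cos (INR (S n) * t) * cos t - cos (INR n * t)).
      { replace ((INR (S n) + 1) * t) with (INR (S n) * t + t) by ring.
        replace (INR n * t) with (INR (S n) * t - t) by (rewrite S_INR; ring).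
        rewrite cos_plus, cos_minus. ring. }
      rewrite C, <- Hx. lra. }
  destruct k as [|k]; [apply (Hboth 0%nat); lia|apply (Hboth k); lia].
Qed.
(** Summation by parts against 2 sin(t/2) cos(k t) = sin((k + 1/2) t) - sin((k - 1/2) t). *)
Lemma cos_sum_by_parts (W : nat -> R) (n : nat) (t : R) : W 0%nat = 0 ->
  2 * sin (t / 2) * sum_n (fun k => W k * cos (INR k * t)) (S n)
  = W (S n) * sin ((INR (S n) + / 2) * t)
    - sum_n (fun k => (W (S k) - W k) * sin ((INR k + / 2) * t)) n.
Proof.
  intros H0.
  assert (Hp : forall k, 2 * sin (t / 2) * cos (INR (S k) * t)
     = sin ((INR (S k) + / 2) * t) - sin ((INR k + / 2) * t)).
  { intros k.
    replace ((INR (S k) + / 2) * t) with (INR (S k) * t + t / 2) by field.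
    replace ((INR k + / 2) * t) with (INR (S k) * t - t / 2) by (rewrite S_INR; field).
    rewrite sin_plus, sin_minus. ring. }
  induction n as [|n IH].
  - rewrite sum_n_succ, !sum_n_zero, H0. 
    rewrite Rmult_plus_distr_l.
    transitivity (W 1%nat * (2 * sin (t / 2) * cos (INR 1 * t))); [ring|].
    rewrite Hp. ring.
  - rewrite sum_n_succ, (sum_n_succ (fun k => (W (S k) - W k) * sin ((INR k + / 2) * t)) n).
    rewrite Rmult_plus_distr_l, IH.
    transitivity (W (S n) * sin ((INR (S n) + / 2) * t)
       - sum_n (fun k => (W (S k) - W k) * sin ((INR k + / 2) * t)) n
       + W (S (S n)) * (2 * sin (t / 2) * cos (INR (S (S n)) * t))); [ring|].
    rewrite Hp. ring.
Qed.

Lemma cos_INR_PI (m : nat) : cos (INR m * PI) = (- 1) ^ m.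
Proof.
  induction m as [|m IH]; [simpl; now rewrite Rmult_0_l, cos_0|].
  rewrite S_INR, Rmult_plus_distr_r, Rmult_1_l, neg_cos, IH. simpl. ring.
Qed.

Lemma sin_INR_PI (m : nat) : sin (INR m * PI) = 0.
Proof.
  induction m as [|m IH]; [simpl; now rewrite Rmult_0_l, sin_0|].
  rewrite S_INR, Rmult_plus_distr_r, Rmult_1_l, neg_sin, IH. ring.
Qed.

(** The zeros of cos((N + 1/2) t) in (0, pi]: there the boundary term of the summation by
    parts has modulus W_N and alternating sign. *)
Definition node (N m : nat) : R := (INR m + / 2) * PI / (INR N + / 2).

Lemma node_bounds (N m : nat) : (m <= N)%nat -> 0 < node N m <= PI.
Proof.
  intros H. apply le_INR in H. pose proof (pos_INR m). pose proof PI_RGT_0.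
  unfold node. split.
  - apply Rdiv_lt_0_compat; [apply Rmult_lt_0_compat|]; lra.
  - apply Rmult_le_reg_r with (INR N + / 2); [lra|].
    unfold Rdiv. rewrite Rmult_assoc, Rinv_l, Rmult_1_r by lra.
    rewrite Rmult_comm. apply Rmult_le_compat_l; lra.
Qed.

Lemma neg1_pow_sqr (m : nat) : (- 1) ^ m * (- 1) ^ m = 1.
Proof. rewrite <- Rpow_mult_distr. replace (-1 * -1) with 1 by ring. apply pow1. Qed.

(** After summation by parts the boundary term W_N sin((N + 1/2) t) equals W_N in modulus at
    the nodes, while the remaining terms carry nonnegative coefficients of total W_N.
    The last of them is strictly smaller than its coefficient, which makes the sign strict. *)
Lemma increasing_cos_sum_alternates (W : nat -> R) (n m : nat) :
  W 0%nat = 0 -> (forall k, (k <= n)%nat -> W k <= W (S k)) -> W n < W (S n) ->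
  (m <= S n)%nat ->
  0 < (- 1) ^ m * sum_n (fun k => W k * cos (INR k * node (S n) m)) (S n).
Proof.
  intros H0 Hinc Hlast Hm.
  set (t := node (S n) m).
  destruct (node_bounds (S n) m Hm) as [Ht0 Ht1]. fold t in Ht0, Ht1.
  set (e := (- 1) ^ m).
  assert (Hang : (INR (S n) + / 2) * t = INR m * PI + PI / 2).
  { unfold t, node. pose proof (pos_INR (S n)). field. lra. }
  assert (Hs : sin ((INR (S n) + / 2) * t) = e).
  { rewrite Hang, sin_plus, sin_PI2, cos_PI2, cos_INR_PI. unfold e. ring. }
  assert (Hc : cos ((INR (S n) + / 2) * t) = 0).
  { rewrite Hang, cos_plus, sin_PI2, cos_PI2, sin_INR_PI. ring. }
  assert (Hee : e * e = 1) by apply neg1_pow_sqr.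
  assert (Hae : Rabs e = 1).
  { unfold e. rewrite <- RPow_abs, Rabs_left by lra. replace (- -1) with 1 by ring. apply pow1. }
  (* The last angle is the boundary angle minus t, which gives the strict inequality. *)
  assert (Hlastsin : e * sin ((INR n + / 2) * t) = cos t).
  { replace ((INR n + / 2) * t) with ((INR (S n) + / 2) * t - t) by (rewrite S_INR; ring).
    rewrite sin_minus, Hs, Hc. transitivity (e * e * cos t); [ring|]. rewrite Hee; ring. }
  assert (Hcos : cos t < 1).
  { rewrite <- cos_0. apply cos_decreasing_1; lra. }
  assert (Hsin : 0 < sin (t / 2)) by (apply sin_gt_0; lra).
  assert (Hdiff : e * sum_n (fun k => (W (S k) - W k) * sin ((INR k + / 2) * t)) n
     < W (S n)).
  { replace (W (S n)) with (sum_n (fun k => W (S k) - W k) n) by (rewrite sum_n_telescope; lra).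
    assert (Hle : forall j, (j <= n)%nat ->
      e * ((W (S j) - W j) * sin ((INR j + / 2) * t)) <= W (S j) - W j).
    { intros j Hj. specialize (Hinc j Hj).
      assert (Hb : e * sin ((INR j + / 2) * t) <= 1).
      { eapply Rle_trans; [apply Rle_abs|]. rewrite Rabs_mult, Hae, Rmult_1_l.
        apply Rabs_le. apply SIN_bound. }
      replace (e * ((W (S j) - W j) * sin ((INR j + / 2) * t)))
        with ((W (S j) - W j) * (e * sin ((INR j + / 2) * t))) by ring.
      rewrite <- (Rmult_1_r (W (S j) - W j)) at 2. apply Rmult_le_compat_l; lra. }
    assert (Hfin : e * ((W (S n) - W n) * sin ((INR n + / 2) * t)) < W (S n) - W n).
    { replace (e * ((W (S n) - W n) * sin ((INR n + / 2) * t)))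
        with ((W (S n) - W n) * (e * sin ((INR n + / 2) * t))) by ring.
      rewrite Hlastsin. rewrite <- (Rmult_1_r (W (S n) - W n)) at 2.
      apply Rmult_lt_compat_l; lra. }
    clearbody t e. clear - Hle Hfin. destruct n as [|n].
    - rewrite !sum_n_zero. exact Hfin.
    - rewrite !sum_n_succ.  rewrite Rmult_plus_distr_l.
      apply Rplus_le_lt_compat; auto.
      assert (Hle' : forall j, (j <= n)%nat ->
         e * ((W (S j) - W j) * sin ((INR j + / 2) * t)) <= W (S j) - W j)
        by (intros; apply Hle; lia).
      clear - Hle'. induction n as [|n IH].
      + rewrite !sum_n_zero. apply Hle'; lia.
      + rewrite !sum_n_succ.  rewrite Rmult_plus_distr_l.
        apply Rplus_le_compat; [apply IH; intros; apply Hle'; lia|apply Hle'; lia]. }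
  pose proof (cos_sum_by_parts W n t H0) as Hp. rewrite Hs in Hp.
  apply Rmult_lt_reg_l with (2 * sin (t / 2)); [lra|]. rewrite Rmult_0_r.
  replace (2 * sin (t / 2) * (e * sum_n (fun k => W k * cos (INR k * t)) (S n)))
    with (e * (2 * sin (t / 2) * sum_n (fun k => W k * cos (INR k * t)) (S n))) by ring.
  rewrite Hp, Rmult_minus_distr_l.
  replace (e * (W (S n) * e)) with (W (S n)) by (transitivity (W (S n) * (e * e)); [rewrite Hee|]; ring).
  lra.
Qed.

(** * A discrete beta law with exact moments *)

(** The mass of {k, ..., N} under the discrete law, for k >= 1: a discrete form of the tail
    (1 - t^2)^s of the law of t at t = k/N.  For s = 0 and k = N + 1 the quotient is 0/0,
    which evaluates to 0 as it should. *)
Fixpoint beta_tail (s : R) (N k : nat) : R :=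
  match k with
  | O => 1
  | S i => beta_tail s N i * ((INR N - INR i) * (INR N + INR i + s))
             / ((INR N - INR i + s) * (INR N + INR i))
  end.

Definition beta_weight (s : R) (N k : nat) : R := beta_tail s N k - beta_tail s N (S k).

Lemma beta_tail_pos (s : R) (N k : nat) : 0 <= s -> (k <= N)%nat -> 0 < beta_tail s N k.
Proof.
  intros Hs. induction k as [|k IH]; intros Hk; cbn [beta_tail]; [lra|].
  assert (HkN : INR k + 1 <= INR N) by (rewrite <- S_INR; apply le_INR; lia).
  pose proof (pos_INR k).
  apply Rdiv_lt_0_compat; [apply Rmult_lt_0_compat; [apply IH; lia|]|];
    apply Rmult_lt_0_compat; lra.
Qed.

Lemma beta_tail_end (s : R) (N : nat) : beta_tail s N (S N) = 0.
Proof. cbn [beta_tail]. unfold Rdiv. ring. Qed.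

Lemma beta_weight_0 (s : R) (N : nat) : 0 <= s -> (0 < N)%nat -> beta_weight s N 0 = 0.
Proof.
  intros Hs HN. apply lt_INR in HN. simpl in HN.
  unfold beta_weight. cbn [beta_tail]. simpl INR. field. lra.
Qed.

Lemma beta_weight_eq (s : R) (N k : nat) : 0 <= s -> (k < N)%nat ->
  beta_weight s N k = beta_tail s N k * (2 * INR k * s)
     / ((INR N - INR k + s) * (INR N + INR k)).
Proof.
  intros Hs Hk. apply lt_INR in Hk. pose proof (pos_INR k).
  unfold beta_weight. cbn [beta_tail]. field. lra.
Qed.

(** The second difference of the tail, divided by its middle value, where a = N - k and
    b = N + k + 1.  The two fractions are the ratios of the tail at k + 2 and at k to the
    tail at k + 1; the case a = 1 is the end point, where the first one vanishes. *)
Lemma concave_step (s a b : R) : 0 <= s <= 1 -> 1 <= a -> a + 1 <= b ->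
  (a - 1) * (b + s) / ((a - 1 + s) * b) + (a + s) * (b - 1) / (a * (b - 1 + s)) <= 2 /\
  (a = 1 -> (a - 1) * (b + s) / ((a - 1 + s) * b) + (a + s) * (b - 1) / (a * (b - 1 + s)) < 2).
Proof.
  intros Hs Ha Hb.
  assert (H1 : a = 1 -> (a - 1) * (b + s) / ((a - 1 + s) * b)
      + (a + s) * (b - 1) / (a * (b - 1 + s)) < 2).
  { intros ->. replace ((1 - 1) * (b + s) / ((1 - 1 + s) * b)) with 0 by (unfold Rdiv; ring).
    rewrite Rplus_0_l. apply Rmult_lt_reg_r with (1 * (b - 1 + s)); [lra|].
    unfold Rdiv. rewrite Rmult_assoc, Rinv_l by lra. nra. }
  split; auto. destruct (Rle_lt_or_eq_dec 1 a Ha) as [Hc|Hc]; [|left; auto].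
  assert (D1 : 0 < (a - 1 + s) * b) by (apply Rmult_lt_0_compat; lra).
  assert (D2 : 0 < a * (b - 1 + s)) by (apply Rmult_lt_0_compat; lra).
  assert (E : 2 - ((a - 1) * (b + s) / ((a - 1 + s) * b)
       + (a + s) * (b - 1) / (a * (b - 1 + s)))
     = s * ((b - a + 1) * (a * (b - 1 + s)) - (b - 1 - a) * ((a - 1 + s) * b))
       / (((a - 1 + s) * b) * (a * (b - 1 + s)))) by (field; lra).
  assert (0 <= s * ((b - a + 1) * (a * (b - 1 + s)) - (b - 1 - a) * ((a - 1 + s) * b))
       / (((a - 1 + s) * b) * (a * (b - 1 + s)))); [|lra].
  apply Rmult_le_pos; [|left; apply Rinv_0_lt_compat; now apply Rmult_lt_0_compat].
  apply Rmult_le_pos; [lra|].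
  assert (D12 : (a - 1 + s) * b <= a * (b - 1 + s)) by nra.
  assert ((b - 1 - a) * ((a - 1 + s) * b) <= (b - 1 - a) * (a * (b - 1 + s)))
    by (apply Rmult_le_compat_l; lra).
  nra.
Qed.

(** The tail is a concave function of k. *)
Lemma beta_weight_increasing (s : R) (n k : nat) : 0 <= s <= 1 -> (k <= n)%nat ->
  beta_weight s (S n) k <= beta_weight s (S n) (S k) /\
  (k = n -> beta_weight s (S n) k < beta_weight s (S n) (S k)).
Proof.
  intros Hs Hk. pose proof (pos_INR k).
  assert (HkN : INR k + 1 <= INR (S n)) by (rewrite <- S_INR; apply le_INR; lia).
  set (M := INR (S n)) in *.
  set (a := M - INR k). set (b := M + INR k + 1).
  pose proof (beta_tail_pos s (S n) (S k) (proj1 Hs) ltac:(lia)) as Ht.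
  set (t := beta_tail s (S n) (S k)) in *.
  assert (H2 : beta_tail s (S n) (S (S k)) = t * ((a - 1) * (b + s) / ((a - 1 + s) * b))).
  { unfold t. change (beta_tail s (S n) (S (S k))) with
      (beta_tail s (S n) (S k) * ((INR (S n) - INR (S k)) * (INR (S n) + INR (S k) + s))
             / ((INR (S n) - INR (S k) + s) * (INR (S n) + INR (S k)))).
    fold M. rewrite (S_INR k). unfold a, b.
    replace (M - (INR k + 1)) with (M - INR k - 1) by ring.
    replace (M + (INR k + 1)) with (M + INR k + 1) by ring.
    unfold Rdiv. ring. }
  assert (H0 : beta_tail s (S n) k = t * ((a + s) * (b - 1) / (a * (b - 1 + s)))).
  { unfold t. cbn [beta_tail]. fold M. unfold a, b. field. lra. }
  destruct (concave_step s a b Hs ltac:(unfold a; lra) ltac:(unfold a, b; lra)) as [C1 C2].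
  unfold beta_weight. fold t. rewrite H0, H2. split.
  - nra.
  - intros ->. assert (Ea : a = 1) by (unfold a, M; rewrite S_INR; ring).
    specialize (C2 Ea). nra.
Qed.

Lemma beta_weight_nonneg (s : R) (n k : nat) : 0 <= s <= 1 -> (k <= S n)%nat ->
  0 <= beta_weight s (S n) k.
Proof.
  intros Hs. induction k as [|k IH]; intros Hk.
  - rewrite beta_weight_0; [lra|lra|lia].
  - pose proof (beta_weight_increasing s n k Hs ltac:(lia)). specialize (IH ltac:(lia)). lra.
Qed.

Lemma beta_weight_total (s : R) (N : nat) : sum_n (beta_weight s N) N = 1 :> R.
Proof.
  assert (H : sum_n (fun k => beta_tail s N (S k) - beta_tail s N k) N
     = beta_tail s N (S N) - beta_tail s N 0 :> R) by apply (sum_n_telescope (beta_tail s N)).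
  rewrite beta_tail_end in H. change (beta_tail s N 0) with 1 in H.
  assert (E : forall n, sum_n (beta_weight s N) n =
     - sum_n (fun k => beta_tail s N (S k) - beta_tail s N k) n :> R).
  { induction n as [|n IH].
    - rewrite !sum_n_zero. unfold beta_weight. ring.
    - rewrite !sum_n_succ, IH. unfold beta_weight. ring. }
  rewrite E, H. ring.
Qed.

(** The density of t is an increasing function times t, and the discrete weights
    keep this property. *)
Lemma beta_weight_div_increasing (s : R) (N k : nat) : 0 <= s <= 1 -> (0 < k)%nat ->
  (S k < N)%nat ->
  beta_weight s N k / INR k <= beta_weight s N (S k) / INR (S k).
Proof.
  intros Hs Hk HkN. 
  rewrite (beta_weight_eq s N k), (beta_weight_eq s N (S k)) by (lra || lia).
  pose proof (beta_tail_pos s N k (proj1 Hs) ltac:(lia)) as Ht.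
  cbn [beta_tail]. set (t := beta_tail s N k) in *.
  apply lt_INR in Hk. apply lt_INR in HkN. simpl (INR 0) in Hk. rewrite S_INR in *.
  set (x := INR k) in *. set (M := INR N) in *.
  apply Rminus_le_0.
  replace (_ - _) with (2 * s * t / ((M - x + s) * (M + x))
     * ((M - x) * (M + x + s) - (M - x - 1 + s) * (M + x + 1))
     / ((M - x - 1 + s) * (M + x + 1))) by (field; repeat split; lra).
  assert (P1 : 0 < (M - x + s) * (M + x)) by (apply Rmult_lt_0_compat; lra).
  assert (P2 : 0 < (M - x - 1 + s) * (M + x + 1)) by (apply Rmult_lt_0_compat; lra).
  apply Rmult_le_pos; [apply Rmult_le_pos|left; now apply Rinv_0_lt_compat].
  - apply Rmult_le_pos; [|left; now apply Rinv_0_lt_compat].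
    apply Rmult_le_pos; lra.
  - replace ((M - x) * (M + x + s) - (M - x - 1 + s) * (M + x + 1))
      with ((1 - s) * (2 * x + 1)) by ring. apply Rmult_le_pos; lra.
Qed.

(** The moments j! / (s + 1)_j of the beta law, that is, the even moments of t. *)
Fixpoint beta_moment (s : R) (j : nat) : R :=
  match j with
  | O => 1
  | S i => beta_moment s i * ((INR i + 1) / (INR i + 1 + s))
  end.

(** The ratio of the j-th central factorial moment of the discrete law, scaled by
    (N (N + s))^j, to the moment of the beta law.  This scale, rather than N^(2j), keeps
    the ratio in [0, 1]. *)
Fixpoint thinning (s : R) (N j : nat) : R :=
  match j with
  | O => 1
  | S i => thinning s N i
      * ((INR N - INR i) * (INR N + INR i + s) / (INR N * (INR N + s)))
  end.

Lemma central_factorial_at_0 (j : nat) : central_factorial (S j) 0 = 0.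
Proof. apply (central_factorial_zero (S j) 0). lia. Qed.

(** The difference of the two sides is a telescoping sum, found by matching the
    coefficients of an antisymmetric cubic in k - 1/2. *)
Lemma beta_moment_recursion (s : R) (N j : nat) : 0 <= s -> (0 < N)%nat ->
  (INR j + 1 + s) * sum_n (fun k => beta_weight s N k * central_factorial (S j) (INR k)) N
  = (INR j + 1) * ((INR N - INR j) * (INR N + INR j + s))
    * sum_n (fun k => beta_weight s N k * central_factorial j (INR k)) N :> R.
Proof.
  intros Hs HN.
  (* L is the difference of the two sides, and (j + 1) E telescopes the differences of L
     weighted by the tail. *)
  set (A := (INR N - INR j) * (INR N + INR j + s)).
  set (L := fun x => (INR j + 1 + s) * central_factorial (S j) x
                     - (INR j + 1) * A * central_factorial j x).
  set (E := fun k => beta_tail s N k * ((INR N - INR k) * (INR N + INR k + s))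
                     * central_factorial j (INR k)).
  assert (Hstep : forall k, (k < N)%nat ->
    beta_tail s N (S k) * (L (INR (S k)) - L (INR k)) = (INR j + 1) * (E k - E (S k))).
  { intros k Hk. apply lt_INR in Hk. pose proof (pos_INR k) as Hk0.
    unfold E. rewrite S_INR.
    replace (beta_tail s N k * ((INR N - INR k) * (INR N + INR k + s)))
      with (beta_tail s N (S k) * ((INR N - INR k + s) * (INR N + INR k)))
      by (cbn [beta_tail]; field; lra).
    set (t := beta_tail s N (S k)). unfold L, A.
    destruct j as [|j].
    - simpl. ring.
    - change (central_factorial (S (S j)) ?y)
        with (central_factorial (S j) y * (y ^ 2 - INR (S j) ^ 2)).
      destruct (central_factorial_half j (INR k)) as [-> ->].
      rewrite (S_INR j). ring. }
  assert (Hsum : forall n, (n <= N)%nat ->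
    sum_n (fun k => beta_weight s N k * L (INR k)) n
    = (INR j + 1) * (E 0%nat - E n) + L 0 - beta_tail s N (S n) * L (INR n) :> R).
  { induction n as [|n IH]; intros Hn.
    - rewrite sum_n_zero. unfold beta_weight. change (INR 0) with 0.
      cbn [beta_tail]. ring.
    - rewrite sum_n_succ, IH by lia. specialize (Hstep n ltac:(lia)).
      unfold beta_weight. lra. }
  specialize (Hsum N (le_n N)). rewrite beta_tail_end in Hsum.
  assert (HEN : E N = 0) by (unfold E; ring).
  assert (HE0 : (INR j + 1) * E 0%nat + L 0 = 0).
  { unfold E, L, A. change (INR 0) with 0. cbn [beta_tail].
    rewrite central_factorial_at_0. destruct j as [|j].
    - simpl. ring.
    - rewrite central_factorial_at_0. ring. }
  rewrite HEN in Hsum.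
  assert (Hlin : forall n, sum_n (fun k => beta_weight s N k * L (INR k)) n
    = (INR j + 1 + s) * sum_n (fun k => beta_weight s N k * central_factorial (S j) (INR k)) n
      - (INR j + 1) * A * sum_n (fun k => beta_weight s N k * central_factorial j (INR k)) n :> R).
  { unfold L. induction n as [|n IH].
    - rewrite !sum_n_zero. ring.
    - rewrite !sum_n_succ, IH. ring. }
  rewrite Hlin in Hsum. lra.
Qed.

Lemma beta_weight_moment (s : R) (N j : nat) : 0 <= s -> (0 < N)%nat ->
  sum_n (fun k => beta_weight s N k * central_factorial j (INR k)) N
  = beta_moment s j * thinning s N j * (INR N * (INR N + s)) ^ j :> R.
Proof.
  intros Hs HN. induction j as [|j IH].
  - simpl. rewrite (sum_n_ext _ (beta_weight s N)) by (intros; apply Rmult_1_r).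
    rewrite beta_weight_total. ring.
  - pose proof (beta_moment_recursion s N j Hs HN) as H. rewrite IH in H.
    pose proof (pos_INR j). apply lt_INR in HN. simpl in HN.
    apply Rmult_eq_reg_l with (INR j + 1 + s); [|lra]. rewrite H.
    cbn [beta_moment thinning pow]. field. lra.
Qed.

(** * The sharp bounds for the cosine transform of a beta law *)

Lemma beta_moment_bounds (s : R) (j : nat) : 0 <= s -> 0 < beta_moment s j <= 1.
Proof.
  intros Hs. induction j as [|j IH]; cbn [beta_moment]; [lra|].
  pose proof (pos_INR j).
  assert (Hq : 0 < (INR j + 1) / (INR j + 1 + s) <= 1).
  { split; [apply Rdiv_lt_0_compat; lra|].
    apply Rmult_le_reg_r with (INR j + 1 + s); [lra|].
    unfold Rdiv. rewrite Rmult_assoc, Rinv_l; lra. }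
  split; [apply Rmult_lt_0_compat; lra|].
  apply Rle_trans with (1 * 1); [apply Rmult_le_compat; lra|lra].
Qed.

Lemma thinning_eq0 (s : R) (N j : nat) : (N < j)%nat -> thinning s N j = 0.
Proof.
  induction j as [|j IH]; intros H; [lia|]. cbn [thinning].
  destruct (Nat.eq_dec j N) as [->|Hne]; [unfold Rdiv; ring|].
  rewrite IH by lia. ring.
Qed.

Lemma thinning_bounds (s : R) (n j : nat) : 0 <= s -> 0 <= thinning s (S n) j <= 1.
Proof.
  intros Hs. induction j as [|j IH]; [simpl; lra|].
  destruct (Nat.le_gt_cases (S n) j) as [Hj|Hj].
  - cbn [thinning]. destruct (Nat.eq_dec j (S n)) as [->|Hne].
    + unfold Rdiv. replace (_ - _) with 0 by ring. lra.
    + rewrite thinning_eq0 by lia. lra.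
  - cbn [thinning]. apply le_INR in Hj. rewrite S_INR in Hj.
    pose proof (pos_INR j). set (M := INR (S n)) in *. set (x := INR j) in *.
    assert (HM : 0 < M * (M + s)) by (apply Rmult_lt_0_compat; lra).
    assert (Hq : 0 <= (M - x) * (M + x + s) / (M * (M + s)) <= 1).
    { split.
      - apply Rmult_le_pos; [apply Rmult_le_pos; lra|left; now apply Rinv_0_lt_compat].
      - apply Rmult_le_reg_r with (M * (M + s)); auto.
        unfold Rdiv. rewrite Rmult_assoc, Rinv_l by lra. nra. }
    split; [apply Rmult_le_pos; lra|].
    apply Rle_trans with (1 * 1); [apply Rmult_le_compat; lra|lra].
Qed.

Lemma thinning_limit (s : R) (j : nat) : 0 <= s ->
  is_lim_seq (fun n => thinning s (S n) j) 1.
Proof.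
  intros Hs. induction j as [|j IH]; [apply is_lim_seq_const|].
  cbn [thinning]. replace (Finite 1) with (Finite (1 * 1)) by (f_equal; ring).
  apply is_lim_seq_mult'; [exact IH|].
  set (c := INR j ^ 2 + INR j * s).
  assert (Hc : 0 <= c) by (pose proof (pos_INR j); unfold c; nra).
  apply is_lim_seq_le_le with (fun n => 1 - c * / INR (S n)) (fun _ => 1).
  - intros n. pose proof (pos_INR n). rewrite S_INR. set (M := INR n + 1).
    assert (HM : 1 <= M) by (unfold M; lra).
    replace ((M - INR j) * (M + INR j + s) / (M * (M + s)))
      with (1 - c * / (M * (M + s))) by (unfold c; field; lra).
    assert (/ (M * (M + s)) <= / M).
    { apply Rinv_le_contravar; [lra|]. nra. }
    assert (0 < / (M * (M + s))) by (apply Rinv_0_lt_compat, Rmult_lt_0_compat; lra).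
    split; nra.
  - replace (Finite 1) with (Finite (1 - c * 0)) by (f_equal; ring).
    apply is_lim_seq_minus'; [apply is_lim_seq_const|].
    apply is_lim_seq_mult'; [apply is_lim_seq_const|].
    apply inv_INR_limit.
  - apply is_lim_seq_const.
Qed.

(** Taylor coefficients of v' as a function of z^2. *)
Definition beta_cos_coef (s : R) (j : nat) : R :=
  (- 1) ^ j * beta_moment s j / INR (fact (2 * j)).

Lemma beta_cos_coef_abs (s : R) (j : nat) : 0 <= s ->
  Rabs (beta_cos_coef s j) <= / INR (fact (2 * j)).
Proof.
  intros Hs. unfold beta_cos_coef, Rdiv.
  rewrite !Rabs_mult, <- RPow_abs, (Rabs_left (-1)) by lra.
  replace (- -1) with 1 by ring. rewrite pow1, Rmult_1_l.
  destruct (beta_moment_bounds s j Hs).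
  pose proof (Rinv_0_lt_compat _ (INR_fact_lt_0 (2 * j))) as Hp.
  rewrite (Rabs_pos_eq (beta_moment s j)), (Rabs_pos_eq (/ _)) by lra. nra.
Qed.

Lemma beta_cos_coef_fact (s : R) (j : nat) : 0 <= s ->
  Rabs (beta_cos_coef s j) <= / INR (fact j).
Proof.
  intros Hs. eapply Rle_trans; [now apply beta_cos_coef_abs|].
  apply Rinv_le_contravar; [apply INR_fact_lt_0|]. apply le_INR, fact_le. lia.
Qed.

Lemma entire_beta_cos (s : R) : 0 <= s -> entire (beta_cos_coef s).
Proof. intros Hs. apply entire_of_le_inv_fact. intros j. now apply beta_cos_coef_fact. Qed.

Definition euler_coef (a : nat -> R) (j : nat) : R := INR j * a j.

Lemma euler_beta_cos_fact (s : R) (j : nat) : 0 <= s ->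
  Rabs (euler_coef (beta_cos_coef s) j) <= / INR (fact j).
Proof.
  intros Hs. unfold euler_coef.
  rewrite Rabs_mult, (Rabs_pos_eq (INR j)) by apply pos_INR.
  apply Rle_trans with (INR j * / INR (fact (2 * j))).
  - apply Rmult_le_compat_l; [apply pos_INR|now apply beta_cos_coef_abs].
  - pose proof (INR_fact_lt_0 j). pose proof (INR_fact_lt_0 (2 * j)).
    assert (Hf : INR j * INR (fact j) <= INR (fact (2 * j))).
    { rewrite <- mult_INR. apply le_INR. destruct j as [|j]; [lia|].
      replace (2 * S j)%nat with (S (S (2 * j))) by lia. rewrite (fact_simpl (S (2 * j))).
      apply Nat.mul_le_mono; [lia|apply fact_le; lia]. }
    apply Rmult_le_reg_r with (INR (fact (2 * j))); auto.
    rewrite Rmult_assoc, Rinv_l, Rmult_1_r by lra.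
    apply Rmult_le_reg_l with (INR (fact j)); auto.
    rewrite <- Rmult_assoc, Rinv_r by lra. lra.
Qed.

Lemma entire_euler_beta_cos (s : R) : 0 <= s -> entire (euler_coef (beta_cos_coef s)).
Proof. intros Hs. apply entire_of_le_inv_fact. intros j. now apply euler_beta_cos_fact. Qed.

Definition thinned (s : R) (n : nat) (a : nat -> R) (j : nat) : R := a j * thinning s (S n) j.

Lemma entire_thinned (s : R) (n : nat) (a : nat -> R) : 0 <= s ->
  (forall j, Rabs (a j) <= / INR (fact j)) -> entire (thinned s n a).
Proof.
  intros Hs H. apply entire_of_le_inv_fact. intros j. unfold thinned.
  destruct (thinning_bounds s n j Hs). specialize (H j).
  rewrite Rabs_mult, (Rabs_pos_eq (thinning s (S n) j)) by lra.
  pose proof (Rabs_pos (a j)). nra.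
Qed.

Definition thinning_error (s : R) (a : nat -> R) (r : R) (n : nat) : R :=
  Series (fun j => Rabs (a j) * (1 - thinning s (S n) j) * r ^ j).

Lemma thinning_error_limit (s : R) (a : nat -> R) (r : R) : 0 <= s -> 0 <= r -> entire a ->
  is_lim_seq (thinning_error s a r) 0.
Proof.
  intros Hs Hr Ha.
  replace (Finite 0) with (Finite (Series (fun _ => 0))).
  2:{ f_equal. transitivity (0 * Series (fun _ : nat => 0)); [|ring].
      rewrite <- Series_scal_l. apply Series_ext. intros; ring. }
  apply (tannery (fun n j => Rabs (a j) * (1 - thinning s (S n) j) * r ^ j)
    (fun _ => 0) (fun j => Rabs (a j) * r ^ j)).
  - intros n j. destruct (thinning_bounds s n j Hs).
    pose proof (pow_le r j Hr). pose proof (Rabs_pos (a j)).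
    rewrite Rabs_pos_eq by (repeat apply Rmult_le_pos; lra).
    apply Rmult_le_compat_r; auto. nra.
  - now apply entire_summable.
  - intros j. replace (Finite 0) with (Finite (Rabs (a j) * (1 - 1) * r ^ j)) by (f_equal; ring).
    apply is_lim_seq_mult'; [|apply is_lim_seq_const].
    apply is_lim_seq_mult'; [apply is_lim_seq_const|].
    apply is_lim_seq_minus'; [apply is_lim_seq_const|now apply thinning_limit].
Qed.

(** The error is bounded uniformly on the disc of radius r, since the ratios lie in [0, 1]. *)
Lemma thinning_error_bound (s : R) (a : nat -> R) (r : R) (n : nat) (z : C) :
  0 <= s -> entire a -> entire (thinned s n a) -> Cmod z <= r ->
  Cmod (CPS a z - CPS (thinned s n a) z)%C <= thinning_error s a r n.
Proof.
  intros Hs Ha Ht Hz. pose proof (Cmod_ge_0 z) as Hz0.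
  pose proof (CPS_summable a z Ha) as S1. pose proof (CPS_summable _ z Ht) as S2.
  unfold CPS.
  replace (CSeries (fun n => (RtoC (a n) * z ^ n)%C)
      - CSeries (fun k => (RtoC (thinned s n a k) * z ^ k)%C))%C
    with (CSeries (fun n => (RtoC (a n) * z ^ n)%C)
      + (- (1)) * CSeries (fun k => (RtoC (thinned s n a k) * z ^ k)%C))%C by ring.
  rewrite <- CSeries_scal, <- CSeries_plus by
    (repeat first [assumption | apply abs_summable_scal]).
  eapply Rle_trans; [apply Cmod_CSeries_le; 
    repeat first [assumption | apply abs_summable_plus | apply abs_summable_scal]|].
  apply Series_le.
  - intros j. split; [apply Cmod_ge_0|].
    replace (RtoC (a j) * z ^ j + - (1) * (RtoC (thinned s n a j) * z ^ j))%C
      with (RtoC (a j) * (RtoC (1 - thinning s (S n) j) * z ^ j))%C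
      by (unfold thinned; rewrite RtoC_mult, RtoC_minus; ring).
    destruct (thinning_bounds s n j Hs).
    rewrite !Cmod_mult, !Cmod_R, Cmod_pow, (Rabs_pos_eq (1 - _)), Rmult_assoc by lra.
    apply Rmult_le_compat_l; [apply Rabs_pos|]. apply Rmult_le_compat_l; [lra|].
    apply pow_incr; lra.
  - apply (ex_series_dominated _ (fun j => Rabs (a j) * r ^ j)).
    + intros j. destruct (thinning_bounds s n j Hs).
      pose proof (pow_le r j ltac:(lra)). pose proof (Rabs_pos (a j)).
      rewrite Rabs_pos_eq by (repeat apply Rmult_le_pos; lra).
      apply Rmult_le_compat_r; auto. nra.
    + apply entire_summable; auto; lra.
Qed.

Lemma PSeries_finite (a : nat -> R) (N : nat) (x : R) :
  (forall j, (N < j)%nat -> a j = 0) -> PSeries a x = sum_n (fun j => a j * x ^ j) N :> R.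
Proof.
  intros H. unfold PSeries. rewrite (Series_split_S _ N).
  - rewrite (Series_ext _ (fun _ => 0 * 0)).
    + rewrite Series_scal_l. ring.
    + intros k. rewrite H by lia. ring.
  - apply (ex_series_incr_n (fun k => a k * x ^ k) (S N)).
    apply (ex_series_ext (fun _ => 0)).
    + intros k. rewrite H by lia. symmetry. apply Rmult_0_l.
    + exists 0. apply is_series_Reals. intros e He. exists 0%nat. intros m _.
      rewrite sum_eq_R0 by auto. now rewrite R_dist_eq.
Qed.

Definition node_value (s : R) (N m : nat) : R :=
  4 * (INR N * (INR N + s)) * sin (node N m / 2) ^ 2.

(** At y = 4 N (N + s) sin^2(t/2) the approximating polynomial is the cosine sum with the
    discrete weights.  Both are sums over the same double array, in the two orders. *)
Lemma thinned_at_node (s : R) (n m : nat) : 0 <= s ->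
  PSeries (thinned s n (beta_cos_coef s)) (node_value s (S n) m)
  = sum_n (fun k => beta_weight s (S n) k * cos (INR k * node (S n) m)) (S n) :> R.
Proof.
  intros Hs. set (t := node (S n) m).
  rewrite (PSeries_finite _ (S n)) by (intros j Hj; unfold thinned; rewrite thinning_eq0 by auto; ring).
  transitivity (sum_n (fun j => sum_n (fun k => chebyshev_coef j * (sin (t / 2) ^ 2) ^ j
      * (beta_weight s (S n) k * central_factorial j (INR k))) (S n)) (S n)).
  - apply sum_n_ext. intros j. rewrite sum_n_scale, beta_weight_moment by (auto; lia).
    unfold thinned, beta_cos_coef, chebyshev_coef, node_value. fold t.
    rewrite !Rpow_mult_distr. replace (-4) with (-1 * 4) by ring. rewrite Rpow_mult_distr.
    unfold Rdiv. match goal with |- ?x = ?y => change (x = y :> R) end. ring.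
  - rewrite sum_n_switch. apply sum_n_ext_loc. intros k Hk.
    rewrite <- (chebyshev_cos (S n) k t Hk). unfold chebyshev_sum. rewrite <- sum_n_scale.
    apply sum_n_ext. intros j. match goal with |- ?x = ?y => change (x = y :> R) end. ring.
Qed.

Lemma node_value_increasing (s : R) (N m : nat) : 0 <= s -> (0 < N)%nat -> (S m <= N)%nat ->
  0 < node_value s N m < node_value s N (S m).
Proof.
  intros Hs HN Hm. unfold node_value.
  destruct (node_bounds N m ltac:(lia)) as [A1 A2]. destruct (node_bounds N (S m) Hm) as [B1 B2].
  assert (HAB : node N m < node N (S m)).
  { unfold node. rewrite S_INR. pose proof PI_RGT_0. pose proof (pos_INR N).
    apply Rmult_lt_compat_r; [apply Rinv_0_lt_compat; lra|].
    apply Rmult_lt_compat_r; lra. }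
  assert (S1 : 0 < sin (node N m / 2)) by (apply sin_gt_0; lra).
  assert (S2 : sin (node N m / 2) < sin (node N (S m) / 2)) by (apply sin_increasing_1; lra).
  apply lt_INR in HN. simpl in HN.
  assert (0 < 4 * (INR N * (INR N + s))) by (repeat apply Rmult_lt_0_compat; lra).
  split; [apply Rmult_lt_0_compat; [auto|nra]|].
  apply Rmult_lt_compat_l; [auto|nra].
Qed.

Lemma thinned_sign (s : R) (n m : nat) : 0 <= s <= 1 -> (m <= S n)%nat ->
  0 < (- 1) ^ m * PSeries (thinned s n (beta_cos_coef s)) (node_value s (S n) m).
Proof.
  intros Hs Hm. rewrite thinned_at_node by lra.
  apply increasing_cos_sum_alternates; auto.
  - apply beta_weight_0; [lra|lia].
  - intros k Hk. now apply beta_weight_increasing.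
  - now apply beta_weight_increasing.
Qed.

Lemma entire_continuity (a : nat -> R) : entire a -> continuity (PSeries a).
Proof. intros H x. apply PSeries_continuity. rewrite H. exact I. Qed.

(** One root between consecutive nodes, by the intermediate value theorem; hence
    as many positive roots as the degree allows when M is the degree. *)
Lemma thinned_roots (s : R) (n M : nat) : 0 <= s <= 1 -> (M <= S n)%nat ->
  exists ts, NoDup ts /\ length ts = M /\
    forall t, In t ts -> 0 < t < node_value s (S n) M /\
      PSeries (thinned s n (beta_cos_coef s)) t = 0.
Proof.
  intros Hs. set (p := PSeries (thinned s n (beta_cos_coef s))).
  assert (Hc : continuity p).
  { apply entire_continuity, entire_thinned; [lra|].
    intros j. apply beta_cos_coef_fact; lra. }
  induction M as [|M IH]; intros HM.
  - exists nil. repeat split; [constructor|..]; intros; contradiction.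
  - destruct (IH ltac:(lia)) as [ts [Hnd [Hlen Hts]]].
    pose proof (node_value_increasing s (S n) M (proj1 Hs) ltac:(lia) HM) as Hy.
    pose proof (thinned_sign s n M Hs ltac:(lia)) as S1.
    pose proof (thinned_sign s n (S M) Hs HM) as S2. fold p in S1, S2.
    set (y1 := node_value s (S n) M) in *. set (y2 := node_value s (S n) (S M)) in *.
    assert (Hneg : p y1 * p y2 < 0).
    { simpl in S2. pose proof (neg1_pow_sqr M) as He. set (e := (-1) ^ M) in *.
      assert (0 < (e * p y1) * (-1 * e * p y2)) by now apply Rmult_lt_0_compat.
      replace (e * p y1 * (-1 * e * p y2)) with (- ((e * e) * (p y1 * p y2))) in H by ring.
      rewrite He in H. lra. }
    destruct (IVT_cor p y1 y2 Hc ltac:(lra) ltac:(lra)) as [x [Hx Hx0]].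
    assert (x <> y1) by (intros ->; rewrite Hx0 in Hneg; lra).
    assert (x <> y2) by (intros ->; rewrite Hx0 in Hneg; lra).
    exists (x :: ts). split; [|split].
    + constructor; auto. intros Hin. destruct (Hts x Hin). lra.
    + simpl. now rewrite Hlen.
    + intros t [<-|Hin]; [split; [lra|exact Hx0]|]. destruct (Hts t Hin). split; [lra|auto].
Qed.

Definition thinned_list (s : R) (n : nat) : list R :=
  map (thinned s n (beta_cos_coef s)) (seq 0 (S (S n))).

Lemma peval_thinned (s : R) (n : nat) (z : C) :
  peval (thinned_list s n) z = CPS (thinned s n (beta_cos_coef s)) z /\
  euler_peval (thinned_list s n) z = CPS (thinned s n (euler_coef (beta_cos_coef s))) z.
Proof.
  destruct (peval_CPS (thinned s n (beta_cos_coef s)) (S (S n)) 0 z) as [H1 H2].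
  - intros j Hj. unfold thinned. rewrite thinning_eq0 by lia. ring.
  - unfold thinned_list. split.
    + rewrite <- (Cmult_1_l (peval _ _)). exact H1.
    + transitivity (z ^ 0 * (RtoC (INR 0) * peval (map (thinned s n (beta_cos_coef s))
         (seq 0 (S (S n)))) z + euler_peval (map (thinned s n (beta_cos_coef s))
         (seq 0 (S (S n)))) z))%C; [simpl; ring|].
      rewrite H2. apply CSeries_ext. intros j. simpl Nat.add. unfold thinned, euler_coef.
      now rewrite Rmult_assoc.
Qed.

Lemma thinned_bounds_of_positive (s r : R) (n : nat) (z : C) : 0 <= s <= 1 ->
  (forall x, 0 <= x <= r -> 0 < PSeries (thinned s n (beta_cos_coef s)) x) -> Cmod z <= r ->
  Cmod (CPS (thinned s n (euler_coef (beta_cos_coef s))) z)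
      * PSeries (thinned s n (beta_cos_coef s)) r
    <= - PSeries (thinned s n (euler_coef (beta_cos_coef s))) r
       * Cmod (CPS (thinned s n (beta_cos_coef s)) z) /\
  PSeries (thinned s n (beta_cos_coef s)) r <= Cmod (CPS (thinned s n (beta_cos_coef s)) z).
Proof.
  intros Hs Hpos Hz.
  destruct (thinned_roots s n (S n) Hs (le_n _)) as [ts [Hnd [Hlen Hts]]].
  pose proof (real_rooted_bounds (thinned_list s n) ts r z Hnd) as H.
  destruct (peval_thinned s n z) as [E1 E2].
  destruct (peval_thinned s n (RtoC r)) as [E3 E4].
  rewrite E1, E2, E3, E4, !CPS_RtoC in H. simpl Re in H. apply H; auto.
  - unfold thinned_list. now rewrite length_map, length_seq, Hlen.
  - destruct (peval_thinned s n 0) as [-> _]. rewrite CPS_RtoC, PSeries_0.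
    unfold thinned, beta_cos_coef. simpl. f_equal. field.
  - intros t Ht. destruct (Hts t Ht) as [Ht1 Ht2]. split; [lra|].
    destruct (peval_thinned s n (RtoC t)) as [-> _]. now rewrite CPS_RtoC, Ht2.
  - intros x Hx. destruct (peval_thinned s n (RtoC x)) as [-> _]. rewrite CPS_RtoC.
    intros E. apply RtoC_inj in E. specialize (Hpos x Hx). lra.
Qed.

Lemma is_lim_seq_of_error (u e : nat -> R) (l : R) :
  (forall n, Rabs (l - u n) <= e n) -> is_lim_seq e 0 -> is_lim_seq u l.
Proof.
  intros H He. apply is_lim_seq_le_le with (fun n => l - e n) (fun n => l + e n).
  - intros n. specialize (H n). apply Rabs_le_between in H. lra.
  - replace (Finite l) with (Finite (l - 0)) by (f_equal; ring).
    apply is_lim_seq_minus'; [apply is_lim_seq_const|exact He].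
  - replace (Finite l) with (Finite (l + 0)) by (f_equal; ring).
    apply is_lim_seq_plus'; [apply is_lim_seq_const|exact He].
Qed.

Lemma Cmod_diff (u v : C) : Rabs (Cmod u - Cmod v) <= Cmod (u - v)%C.
Proof.
  assert (H : forall a b, Cmod a - Cmod b <= Cmod (a - b)%C).
  { intros a b. pose proof (Cmod_triangle (a - b)%C b) as Ht.
    replace (a - b + b)%C with a in Ht by ring. lra. }
  apply Rabs_le. pose proof (H u v). pose proof (H v u).
  replace (v - u)%C with (- (u - v))%C in H1 by ring. rewrite Cmod_opp in H1. lra.
Qed.

(** Limit of the polynomial inequalities.  Uniform convergence on [0, r] keeps the
    approximants positive there from some index on. *)
Lemma beta_cos_bounds (s r : R) (z : C) : 0 <= s <= 1 ->
  (forall x, 0 <= x <= r -> 0 < PSeries (beta_cos_coef s) x) -> Cmod z <= r ->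
  Cmod (CPS (euler_coef (beta_cos_coef s)) z) * PSeries (beta_cos_coef s) r
    <= - PSeries (euler_coef (beta_cos_coef s)) r * Cmod (CPS (beta_cos_coef s) z) /\
  PSeries (beta_cos_coef s) r <= Cmod (CPS (beta_cos_coef s) z).
Proof.
  intros Hs Hpos Hz. assert (Hr : 0 <= r) by (pose proof (Cmod_ge_0 z); lra).
  assert (Hs0 : 0 <= s) by lra.
  set (a := beta_cos_coef s) in *. set (b := euler_coef a).
  assert (Ha : entire a) by now apply entire_beta_cos.
  assert (Hb : entire b) by now apply entire_euler_beta_cos.
  assert (Hta : forall n, entire (thinned s n a)).
  { intros n. apply entire_thinned; auto. intros j. now apply beta_cos_coef_fact. }
  assert (Htb : forall n, entire (thinned s n b)).
  { intros n. apply entire_thinned; auto. intros j. now apply euler_beta_cos_fact. }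
  pose proof (thinning_error_limit s a r Hs0 Hr Ha) as La.
  pose proof (thinning_error_limit s b r Hs0 Hr Hb) as Lb.
  assert (Hbd : forall c, entire c -> (forall n, entire (thinned s n c)) -> forall n w,
     Cmod w <= r -> Cmod (CPS c w - CPS (thinned s n c) w)%C <= thinning_error s c r n)
    by (intros; apply thinning_error_bound; auto).
  assert (HbR : forall c, entire c -> (forall n, entire (thinned s n c)) -> forall n x,
     0 <= x <= r -> Rabs (PSeries c x - PSeries (thinned s n c) x) <= thinning_error s c r n).
  { intros c Hc Htc n x Hx. rewrite <- Cmod_R, RtoC_minus, <- !CPS_RtoC. apply Hbd; auto.
    rewrite Cmod_R, Rabs_pos_eq; lra. }
  assert (Hlim : forall c, entire c -> (forall n, entire (thinned s n c)) ->
     is_lim_seq (thinning_error s c r) 0 ->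
     is_lim_seq (fun n => Cmod (CPS (thinned s n c) z)) (Cmod (CPS c z)) /\
     is_lim_seq (fun n => PSeries (thinned s n c) r) (PSeries c r)).
  { intros c Hc Htc Lc. split; apply (is_lim_seq_of_error _ (thinning_error s c r)); auto.
    - intros n. eapply Rle_trans; [apply Cmod_diff|]. now apply Hbd.
    - intros n. apply HbR; auto; lra. }
  destruct (Hlim a Ha Hta La) as [A1 A2]. destruct (Hlim b Hb Htb Lb) as [B1 B2].
  destruct (continuity_ab_min (PSeries a) 0 r Hr) as [x0 [Hmin Hx0]].
  { intros x _. now apply entire_continuity. }
  pose proof (Hpos x0 Hx0) as Hm.
  assert (Hev : eventually (fun n =>
     forall x, 0 <= x <= r -> 0 < PSeries (thinned s n a) x)).
  { apply is_lim_seq_spec in La. destruct (La (mkposreal _ Hm)) as [N HN].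
    exists N. intros n Hn x Hx. specialize (HN n Hn). cbn [pos] in HN.
    rewrite Rminus_0_r in HN. pose proof (Rle_abs (thinning_error s a r n)).
    specialize (HbR a Ha Hta n x Hx). apply Rabs_le_between in HbR.
    specialize (Hmin x Hx). lra. }
  split.
  - apply (is_lim_seq_le_loc (fun n => Cmod (CPS (thinned s n b) z) * PSeries (thinned s n a) r)
      (fun n => - PSeries (thinned s n b) r * Cmod (CPS (thinned s n a) z))
      (Cmod (CPS b z) * PSeries a r) (- PSeries b r * Cmod (CPS a z))).
    + revert Hev. apply filter_imp. intros n Hn. now apply thinned_bounds_of_positive.
    + now apply is_lim_seq_mult'.
    + apply is_lim_seq_mult'; auto. exact (proj1 (is_lim_seq_opp _ _) B2).
  - apply (is_lim_seq_le_loc (fun n => PSeries (thinned s n a) r)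
      (fun n => Cmod (CPS (thinned s n a) z)) (PSeries a r) (Cmod (CPS a z))); auto.
    revert Hev. apply filter_imp. intros n Hn. now apply thinned_bounds_of_positive.
Qed.

(** * Positivity of the Gamma function on [1, 2] *)

(** The integrals over compact intervals increase with the interval, so the improper integral
    is their supremum. *)
Lemma RInt_gen_positive (f : R -> R) (M : R) :
  (forall t, 0 < t -> continuous f t) -> (forall t, 0 < t -> 0 < f t) ->
  (forall a b, 0 < a <= b -> RInt f a b <= M) ->
  0 < RInt_gen f (at_right 0) (Rbar_locally p_infty).
Proof.
  intros Hc Hp HM.
  assert (Hex : forall a b, 0 < a -> 0 < b -> ex_RInt f a b).
  { intros a b Ha Hb. apply (ex_RInt_continuous (V := R_CompleteNormedModule)).
    intros t Ht. apply Hc. pose proof (Rmin_Rgt_r a b 0). lra. }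
  assert (Hpos : forall a b, 0 < a <= b -> 0 <= RInt f a b).
  { intros a b Hab. apply RInt_ge_0; [lra|apply Hex; lra|]. intros t Ht. left. apply Hp; lra. }
  set (E := fun I => exists a b, 0 < a <= b /\ I = RInt f a b).
  destruct (completeness E) as [l [Hub Hlub]].
  { exists M. intros I [a [b [Hab ->]]]. now apply HM. }
  { exists (RInt f 1 1), 1, 1. split; [lra|reflexivity]. }
  assert (Hl : 0 < l).
  { apply Rlt_le_trans with (RInt f 1 2).
    - apply RInt_gt_0; [lra|intros; apply Hp; lra|intros; apply Hc; lra].
    - apply Hub. exists 1, 2. split; [lra|reflexivity]. }
  replace (RInt_gen f (at_right 0) (Rbar_locally p_infty)) with l; auto.
  symmetry. apply (is_RInt_gen_unique (V := R_CompleteNormedModule)).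
  intros P [eps HP].
  (* An interval that almost attains the supremum; larger intervals do so too. *)
  assert (Hnear : exists a b, 0 < a <= b /\ l - eps < RInt f a b).
  { destruct (Classical_Prop.classic (exists a b, 0 < a <= b /\ l - eps < RInt f a b)); auto.
    exfalso. assert (l <= l - eps); [|pose proof (cond_pos eps); lra].
    apply Hlub. intros I [a [b [Hab ->]]].
    destruct (Rle_lt_dec (RInt f a b) (l - eps)); auto.
    exfalso; apply H. now exists a, b. }
  destruct Hnear as [a0 [b0 [Hab0 Hnear]]].
  apply (Filter_prod _ _ _ (fun x => 0 < x < a0) (fun y => b0 < y)).
  - assert (Ha0 : 0 < a0) by lra. exists (mkposreal _ Ha0). intros y Hy Hy0.
    unfold ball in Hy; simpl in Hy. unfold AbsRing_ball, abs, minus, plus, opp in Hy; simpl in Hy.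
    rewrite Rabs_pos_eq in Hy; lra.
  - exists b0. auto.
  - intros a b Ha Hb. simpl. exists (RInt f a b). split.
    + apply (RInt_correct (V := R_CompleteNormedModule)), Hex; lra.
    + apply HP.
      assert (Hsum : RInt f a b = RInt f a a0 + RInt f a0 b0 + RInt f b0 b).
      { rewrite <- (RInt_Chasles f a b0 b) by (apply Hex; lra).
        rewrite <- (RInt_Chasles f a a0 b0) by (apply Hex; lra). reflexivity. }
      pose proof (Hpos a a0 ltac:(lra)). pose proof (Hpos b0 b ltac:(lra)).
      assert (RInt f a b <= l) by (apply Hub; exists a, b; split; [lra|reflexivity]).
      unfold ball; simpl. unfold AbsRing_ball, abs, minus, plus, opp; simpl.
      apply Rabs_def1; lra.
Qed.

Lemma Rpower_le_1_plus (t e : R) : 0 < t -> 0 <= e <= 1 -> Rpower t e <= 1 + t.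
Proof.
  intros Ht He. destruct (Rle_lt_dec 1 t) as [H|H].
  - apply Rle_trans with (Rpower t 1); [|rewrite Rpower_1; lra].
    apply Rle_Rpower; lra.
  - apply Rle_trans with 1; [|lra]. unfold Rpower. rewrite <- exp_0.
    assert (Hln : ln t < 0) by (rewrite <- ln_1; apply ln_increasing; lra).
    assert (Hle : e * ln t <= 0) by nra.
    destruct Hle as [Hle|Hle]; [left; now apply exp_increasing|right; now rewrite Hle].
Qed.

Lemma Gamma_positive (x : R) : 1 <= x <= 2 -> 0 < Gamma x.
Proof.
  intros Hx. unfold Gamma.
  set (f := fun t => Rpower t (x - 1) * exp (- t)).
  assert (Hc : forall t, 0 < t -> continuous f t).
  { intros t Ht. apply (ex_derive_continuous (V := R_NormedModule)).
    unfold f, Rpower. auto_derive. auto. }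
  apply (RInt_gen_positive f 2); auto.
  { intros t Ht. unfold f, Rpower. apply Rmult_lt_0_compat; apply exp_pos. }
  intros a b Hab.
  set (g := fun t => (1 + t) * exp (- t)). set (G := fun t => - ((2 + t) * exp (- t))).
  assert (HG : is_RInt g a b (G b - G a)).
  { apply (is_RInt_derive (V := R_CompleteNormedModule) G g).
    - intros t _. unfold G, g. auto_derive; auto. ring.
    - intros t _. apply (ex_derive_continuous (V := R_NormedModule)).
      unfold g. auto_derive. auto. }
  apply Rle_trans with (RInt g a b).
  - apply RInt_le; [lra|..].
    + apply (ex_RInt_continuous (V := R_CompleteNormedModule)). intros t Ht. apply Hc.
      pose proof (Rmin_Rgt_r a b 0). lra.
    + exists (G b - G a). exact HG.
    + intros t Ht. unfold f, g. apply Rmult_le_compat_r; [left; apply exp_pos|].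
      apply Rpower_le_1_plus; lra.
  - rewrite (is_RInt_unique _ _ _ _ HG). unfold G.
    pose proof (exp_ineq1_le a). pose proof (exp_pos (- a)). pose proof (exp_pos (- b)).
    assert (E : exp a * exp (- a) = 1) by (rewrite <- exp_plus, Rplus_opp_r; apply exp_0).
    nra.
Qed.

(** * The sine transform at 2 pi *)

Definition sinc_coef (j : nat) : R := (- 1) ^ j / INR (fact (2 * j + 1)).

Lemma sin_sinc (u : R) : sin u = u * PSeries sinc_coef (u ^ 2).
Proof.
  unfold sin. destruct (exist_sin (Rsqr u)) as [a Ha]. f_equal. symmetry.
  unfold PSeries. apply is_series_unique, is_series_Reals.
  unfold sin_in in Ha. replace (u ^ 2) with (Rsqr u) by (unfold Rsqr; ring). exact Ha.
Qed.

Lemma sinc_coef_abs (j : nat) : Rabs (sinc_coef j) = / INR (fact (2 * j + 1)).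
Proof.
  unfold sinc_coef, Rdiv. rewrite Rabs_mult, <- RPow_abs, (Rabs_left (-1)) by lra.
  replace (- -1) with 1 by ring. rewrite pow1, Rmult_1_l. apply Rabs_pos_eq.
  left. apply Rinv_0_lt_compat, INR_fact_lt_0.
Qed.

Lemma entire_sinc : entire sinc_coef.
Proof.
  apply entire_of_le_inv_fact. intros j. rewrite sinc_coef_abs.
  apply Rinv_le_contravar; [apply INR_fact_lt_0|]. apply le_INR, fact_le. lia.
Qed.

(** Moments interpolating between the ordinary ones (j = 0) and the central factorial ones
    (i = 0); all with i + j fixed have the same limit. *)
Definition mixed_moment (s : R) (n i j : nat) : R :=
  sum_n (fun k => beta_weight s (S n) k * (INR k ^ 2) ^ i * central_factorial j (INR k)) (S n)
  / (INR (S n) ^ 2) ^ (i + j).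

(** From k^2 = (k^2 - j^2) + j^2. *)
Lemma mixed_moment_S (s : R) (n i j : nat) :
  mixed_moment s n (S i) j
  = mixed_moment s n i (S j) + INR j ^ 2 * (/ INR (S n) * / INR (S n)) * mixed_moment s n i j.
Proof.
  unfold mixed_moment. pose proof (INR_S_pos n).
  assert (Hsum : forall N,
    sum_n (fun k => beta_weight s (S n) k * (INR k ^ 2) ^ S i * central_factorial j (INR k)) N
    = sum_n (fun k => beta_weight s (S n) k * (INR k ^ 2) ^ i * central_factorial (S j) (INR k)) N
    + INR j ^ 2 * sum_n (fun k => beta_weight s (S n) k * (INR k ^ 2) ^ i
         * central_factorial j (INR k)) N :> R).
  { induction N as [|N IH].
    - rewrite !sum_n_zero. cbn [central_factorial pow]. ring.
    - rewrite !sum_n_succ, IH. cbn [central_factorial pow]. ring. }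
  rewrite Hsum. replace (i + S j)%nat with (S i + j)%nat by lia.
  change (S i + j)%nat with (S (i + j)).
  set (q := (INR (S n) ^ 2) ^ (i + j)).
  assert (Hq : q <> 0) by (apply pow_nonzero; nra).
  match goal with |- (?x + _ * ?y) / _ = _ => generalize x y end. intros x y.
  change ((INR (S n) ^ 2) ^ S (i + j)) with (INR (S n) ^ 2 * q).
  field. split; [auto|lra].
Qed.

Lemma mixed_moment_limit (s : R) (i j : nat) : 0 <= s ->
  is_lim_seq (fun n => mixed_moment s n i j) (beta_moment s (i + j)).
Proof.
  intros Hs. revert j. induction i as [|i IH]; intros j.
  - apply (is_lim_seq_ext (fun n => beta_moment s j * thinning s (S n) j
      * (1 + s * / INR (S n)) ^ j)).
    + intros n. unfold mixed_moment. pose proof (INR_S_pos n).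
      rewrite (sum_n_ext _ (fun k => beta_weight s (S n) k * central_factorial j (INR k))).
      2:{ intros k. cbn [pow]. now rewrite Rmult_1_r. }
      rewrite beta_weight_moment by (auto; lia). simpl Nat.add.
      replace (INR (S n) * (INR (S n) + s)) with ((1 + s * / INR (S n)) * INR (S n) ^ 2)
        by (field; lra).
      rewrite Rpow_mult_distr. field. apply pow_nonzero. nra.
    + replace (Finite (beta_moment s (0 + j)))
        with (Finite (beta_moment s j * 1 * (1 + s * 0) ^ j)).
      2:{ f_equal. rewrite Rmult_0_r, Rplus_0_r, pow1. simpl Nat.add. ring. }
      apply is_lim_seq_mult'.
      * apply is_lim_seq_mult'; [apply is_lim_seq_const|now apply thinning_limit].
      * assert (L : is_lim_seq (fun n => 1 + s * / INR (S n)) (1 + s * 0)).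
        { apply is_lim_seq_plus'; [apply is_lim_seq_const|].
          apply is_lim_seq_mult'; [apply is_lim_seq_const|apply inv_INR_limit]. }
        induction j as [|j IHj]; [apply is_lim_seq_const|].
        cbn [pow]. now apply is_lim_seq_mult'.
  - apply (is_lim_seq_ext (fun n => mixed_moment s n i (S j)
        + INR j ^ 2 * (/ INR (S n) * / INR (S n)) * mixed_moment s n i j)).
    + intros n. now rewrite mixed_moment_S.
    + replace (Finite (beta_moment s (S i + j)))
        with (Finite (beta_moment s (i + S j) + INR j ^ 2 * (0 * 0) * beta_moment s (i + j))).
      2:{ f_equal. replace (i + S j)%nat with (S i + j)%nat by lia. ring. }
      apply is_lim_seq_plus'; [apply IH|].
      apply is_lim_seq_mult'; [|apply IH].
      apply is_lim_seq_mult'; [apply is_lim_seq_const|].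
      apply is_lim_seq_mult'; apply inv_INR_limit.
Qed.

Lemma mixed_moment_bounds (s : R) (n i : nat) : 0 <= s <= 1 -> 0 <= mixed_moment s n i 0 <= 1.
Proof.
  intros Hs. unfold mixed_moment. pose proof (INR_S_pos n).
  rewrite Nat.add_0_r. set (q := (INR (S n) ^ 2) ^ i).
  assert (Hq : 0 < q) by (apply pow_lt; nra).
  assert (Hterm : forall k, (k <= S n)%nat ->
     0 <= beta_weight s (S n) k * (INR k ^ 2) ^ i * central_factorial 0 (INR k)
       <= q * beta_weight s (S n) k).
  { intros k Hk. pose proof (beta_weight_nonneg s n k Hs Hk). simpl central_factorial.
    apply le_INR in Hk. pose proof (pos_INR k).
    assert (0 <= (INR k ^ 2) ^ i <= q).
    { split; [apply pow_le, pow_le; auto|]. apply pow_incr. split; [apply pow_le; auto|].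
      apply pow_incr; lra. }
    split; [|nra]. apply Rmult_le_pos; [|lra]. apply Rmult_le_pos; lra. }
  assert (Hs2 : 0 <= sum_n (fun k => beta_weight s (S n) k * (INR k ^ 2) ^ i
       * central_factorial 0 (INR k)) (S n) <= q).
  { assert (Hall : forall N, (N <= S n)%nat ->
      0 <= sum_n (fun k => beta_weight s (S n) k * (INR k ^ 2) ^ i
       * central_factorial 0 (INR k)) N <= q * sum_n (beta_weight s (S n)) N).
    { induction N as [|N IH]; intros HN.
      - rewrite !sum_n_zero. now apply Hterm.
      - rewrite !sum_n_succ. specialize (Hterm (S N) HN). specialize (IH ltac:(lia)). lra. }
    specialize (Hall (S n) (le_n _)). rewrite beta_weight_total in Hall. lra. }
  split.
  - apply Rmult_le_pos; [lra|left; now apply Rinv_0_lt_compat].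
  - apply Rmult_le_reg_r with q; auto. unfold Rdiv. rewrite Rmult_assoc, Rinv_l; lra.
Qed.

Lemma Series_sum_n (f : nat -> nat -> R) (N : nat) :
  (forall k, ex_series (f k)) ->
  ex_series (fun i => sum_n (fun k => f k i) N) /\
  Series (fun i => sum_n (fun k => f k i) N) = sum_n (fun k => Series (f k)) N :> R.
Proof.
  intros H. induction N as [|N [I1 I2]].
  - split.
    + eapply ex_series_ext; [|exact (H 0%nat)]. intros i. simpl. now rewrite sum_n_zero.
    + rewrite sum_n_zero. apply Series_ext. intros i. now rewrite sum_n_zero.
  - assert (E : forall i, sum_n (fun k => f k i) (S N) = sum_n (fun k => f k i) N + f (S N) i :> R)
      by (intros; apply sum_n_succ).
    split.
    + eapply ex_series_ext; [intros i; symmetry; apply E|].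
      apply (ex_series_plus (K := R_AbsRing) (V := R_NormedModule)); auto.
    + rewrite (Series_ext _ _ E), Series_plus, sum_n_succ, I2; auto.
Qed.

Definition beta_sinc_coef (s : R) (j : nat) : R := sinc_coef j * beta_moment s j.

(** Here [PSeries sinc_coef (u ^ 2)] is sin u / u, and the limit is v(x)/x at y = x^2. *)
Lemma beta_sinc_limit (s y : R) : 0 <= s <= 1 -> 0 <= y ->
  is_lim_seq (fun n => sum_n (fun k => beta_weight s (S n) k
       * PSeries sinc_coef (y * (INR k / INR (S n)) ^ 2)) (S n))
    (PSeries (beta_sinc_coef s) y).
Proof.
  intros Hs Hy.
  apply (is_lim_seq_ext (fun n => Series (fun i => sinc_coef i * mixed_moment s n i 0 * y ^ i))).
  - intros n. pose proof (INR_S_pos n).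
    destruct (Series_sum_n (fun k i => beta_weight s (S n) k *
        (sinc_coef i * (y * (INR k / INR (S n)) ^ 2) ^ i)) (S n)) as [_ E].
    { intros k. apply ex_series_Rscal.
      apply (ex_series_dominated _ (fun i => Rabs (sinc_coef i) * (y * (INR k / INR (S n)) ^ 2) ^ i)).
      - intros i. rewrite Rabs_mult, (Rabs_pos_eq (_ ^ i)); [lra|].
        apply pow_le, Rmult_le_pos; [auto|apply pow2_ge_0].
      - apply entire_summable; [apply entire_sinc|].
        apply Rmult_le_pos; [auto|apply pow2_ge_0]. }
    rewrite (sum_n_ext _ (fun k => Series (fun i => beta_weight s (S n) k *
        (sinc_coef i * (y * (INR k / INR (S n)) ^ 2) ^ i)))).
    2:{ intros k. now rewrite Series_scal_l. }
    rewrite <- E. apply Series_ext. intros i. unfold mixed_moment.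
    rewrite Nat.add_0_r.
    rewrite (sum_n_ext (fun k => beta_weight s (S n) k * (sinc_coef i * _))
      (fun k => (sinc_coef i * y ^ i / (INR (S n) ^ 2) ^ i) *
         (beta_weight s (S n) k * (INR k ^ 2) ^ i * central_factorial 0 (INR k)))).
    + rewrite sum_n_scale. unfold Rdiv. ring.
    + intros k. match goal with |- ?x = ?y => change (x = y :> R) end.
      rewrite Rpow_mult_distr. unfold Rdiv. rewrite !Rpow_mult_distr, !pow_inv.
      simpl central_factorial. ring.
  - apply (tannery (fun n i => sinc_coef i * mixed_moment s n i 0 * y ^ i)
      (fun i => beta_sinc_coef s i * y ^ i) (fun i => Rabs (sinc_coef i) * y ^ i)).
    + intros n i. destruct (mixed_moment_bounds s n i Hs). pose proof (pow_le y i Hy).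
      pose proof (Rabs_pos (sinc_coef i)).
      rewrite !Rabs_mult, (Rabs_pos_eq (mixed_moment s n i 0)), (Rabs_pos_eq (y ^ i)) by auto.
      apply Rmult_le_compat_r; auto. nra.
    + apply entire_summable; [apply entire_sinc|auto].
    + intros i. unfold beta_sinc_coef. apply is_lim_seq_mult'; [|apply is_lim_seq_const].
      apply is_lim_seq_mult'; [apply is_lim_seq_const|].
      pose proof (mixed_moment_limit s i 0 (proj1 Hs)) as L. now rewrite Nat.add_0_r in L.
Qed.

Lemma sin_sum_period (N : nat) : (2 <= N)%nat ->
  sum_n (fun k => sin (2 * PI * (INR k / INR N))) N = 0 :> R.
Proof.
  intros HN. apply le_INR in HN. simpl in HN. pose proof PI_RGT_0 as HPI.
  set (t := 2 * PI / INR N).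
  assert (Hp : forall n, 2 * sin (t / 2) * sum_n (fun k => sin (2 * PI * (INR k / INR N))) n
    = cos (t / 2) - cos (INR n * t + t / 2) :> R).
  { induction n as [|n IH].
    - rewrite sum_n_zero. simpl INR. unfold Rdiv at 2. rewrite Rmult_0_l, Rmult_0_r, sin_0.
      rewrite Rmult_0_l, Rplus_0_l. ring.
    - rewrite sum_n_succ, Rmult_plus_distr_l, IH.
      replace (2 * PI * (INR (S n) / INR N)) with (INR (S n) * t) by (unfold t; field; lra).
      replace (INR n * t + t / 2) with (INR (S n) * t - t / 2) by (rewrite S_INR; field).
      rewrite cos_plus, cos_minus. ring. }
  specialize (Hp N).
  replace (INR N * t + t / 2) with (t / 2 + 2 * INR 1 * PI) in Hp by (unfold t; simpl; field; lra).
  rewrite cos_period in Hp.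
  assert (Ht : 0 < sin (t / 2)).
  { assert (Ht2 : t / 2 = PI / INR N) by (unfold t; field; lra). rewrite Ht2.
    assert (0 < / INR N) by (apply Rinv_0_lt_compat; lra).
    assert (/ INR N < 1) by (rewrite <- Rinv_1; apply Rinv_lt_contravar; lra).
    apply sin_gt_0; unfold Rdiv; nra. }
  apply Rmult_eq_reg_l with (2 * sin (t / 2)); [|lra]. rewrite Hp. ring.
Qed.

Lemma beta_weight_div_monotone (s : R) (N k l : nat) : 0 <= s <= 1 -> (0 < k)%nat ->
  (k <= l)%nat -> (l < N)%nat -> beta_weight s N k / INR k <= beta_weight s N l / INR l.
Proof.
  intros Hs Hk Hkl. induction Hkl as [|l Hkl IH]; intros Hl; [lra|].
  pose proof (beta_weight_div_increasing s N l Hs ltac:(lia) Hl). specialize (IH ltac:(lia)). lra.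
Qed.

(** The numbers W_k/k increase with k, while the sine is positive on the first half of the
    period and negative on the second: replacing every W_k/k by its value in the middle
    increases the sum, and makes it vanish. *)
Lemma increasing_sin_sum_nonpos (s : R) (N : nat) : 0 <= s <= 1 -> (2 <= N)%nat ->
  sum_n (fun k => beta_weight s N k / INR k * sin (2 * PI * (INR k / INR N))) N <= 0.
Proof.
  intros Hs HN. pose proof (Nat.div2_odd N) as Hodd. set (M := Nat.div2 N) in *.
  assert (HM : (2 * M <= N /\ N <= 2 * M + 1)%nat) by (destruct (Nat.odd N); simpl in Hodd; lia).
  set (c := beta_weight s N M / INR M).
  assert (HNR : 2 <= INR N) by (apply le_INR in HN; simpl in HN; lra).
  pose proof PI_RGT_0.
  assert (Hi : 0 < / INR N) by (apply Rinv_0_lt_compat; lra).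
  assert (Hterm : forall k, (k <= N)%nat ->
    beta_weight s N k / INR k * sin (2 * PI * (INR k / INR N))
    <= c * sin (2 * PI * (INR k / INR N))).
  { intros k Hk. pose proof (pos_INR k).
    (* At k = 0 the quotient W_k / k has the value 0 / 0, but the sine vanishes. *)
    destruct (Nat.eq_dec k 0) as [->|Hk0].
    { simpl INR. unfold Rdiv. rewrite Rmult_0_l, Rmult_0_r, sin_0. lra. }
    destruct (Nat.eq_dec k N) as [->|HkN].
    { unfold Rdiv. rewrite Rinv_r, Rmult_1_r, sin_2PI by lra. lra. }
    assert (Hfrac : INR k * / INR N * INR N = INR k) by (field; lra).
    destruct (Nat.le_gt_cases k M) as [HkM|HkM].
    - assert (Hsin : 0 <= sin (2 * PI * (INR k / INR N))).
      { assert (INR k / INR N <= / 2).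
        { assert (2 * INR k <= INR N) by (change 2 with (INR 2); rewrite <- mult_INR; apply le_INR; lia).
          unfold Rdiv. nra. }
        assert (0 <= INR k / INR N) by (unfold Rdiv; nra).
        apply sin_ge_0; nra. }
      apply Rmult_le_compat_r; auto.
      apply beta_weight_div_monotone; auto; lia.
    - assert (Hsin : sin (2 * PI * (INR k / INR N)) <= 0).
      { assert (/ 2 <= INR k / INR N).
        { assert (INR N <= 2 * INR k) by (change 2 with (INR 2); rewrite <- mult_INR; apply le_INR; lia).
          unfold Rdiv. nra. }
        assert (INR k / INR N <= 1).
        { apply le_INR in Hk. unfold Rdiv. nra. }
        apply sin_le_0; nra. }
      assert (Hle : c <= beta_weight s N k / INR k) by (apply beta_weight_div_monotone; auto; lia).
      nra. }
  apply Rle_trans with (c * sum_n (fun k => sin (2 * PI * (INR k / INR N))) N).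
  - assert (Hall : forall n, (n <= N)%nat ->
      sum_n (fun k => beta_weight s N k / INR k * sin (2 * PI * (INR k / INR N))) n
      <= c * sum_n (fun k => sin (2 * PI * (INR k / INR N))) n).
    { induction n as [|n IH]; intros Hn.
      - rewrite !sum_n_zero. now apply Hterm.
      - rewrite !sum_n_succ. specialize (Hterm (S n) Hn). specialize (IH ltac:(lia)). lra. }
    now apply Hall.
  - rewrite sin_sum_period by auto. lra.
Qed.

Lemma beta_sinc_nonpos (s : R) : 0 <= s <= 1 -> PSeries (beta_sinc_coef s) ((2 * PI) ^ 2) <= 0.
Proof.
  intros Hs. pose proof PI_RGT_0.
  pose proof (beta_sinc_limit s ((2 * PI) ^ 2) Hs (pow2_ge_0 _)) as L.
  apply (is_lim_seq_le_loc _ (fun _ => 0) _ 0) with (2 := L); [|apply is_lim_seq_const].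
  (* The bound on the sine sum needs two sample points, whence the index 1. *)
  exists 1%nat. intros n Hn. pose proof (INR_S_pos n) as HN.
  rewrite (sum_n_ext _ (fun k => (INR (S n) / (2 * PI)) *
     (beta_weight s (S n) k / INR k * sin (2 * PI * (INR k / INR (S n)))))).
  - rewrite sum_n_scale.
    pose proof (increasing_sin_sum_nonpos s (S n) Hs ltac:(lia)).
    assert (0 < INR (S n) / (2 * PI)) by (apply Rdiv_lt_0_compat; lra). nra.
  - intros k. match goal with |- ?x = ?y => change (x = y :> R) end.
    destruct (Nat.eq_dec k 0) as [->|Hk].
    + rewrite beta_weight_0 by (lra || lia). unfold Rdiv. ring.
    + assert (INR k <> 0) by (now apply not_0_INR).
      rewrite (sin_sinc (2 * PI * (INR k / INR (S n)))), (Rpow_mult_distr (2 * PI)).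
      generalize (PSeries sinc_coef ((2 * PI) ^ 2 * (INR k / INR (S n)) ^ 2)). intros p.
      field. repeat split; lra.
Qed.

(** * Power series of the normalized Struve function *)

Definition even_coef (a : nat -> R) (n : nat) : R :=
  if Nat.even n then a (Nat.div2 n) else 0.

Lemma even_coef_even (a : nat -> R) (j : nat) : even_coef a (2 * j) = a j.
Proof. unfold even_coef. now rewrite Nat.even_mul, Nat.div2_double. Qed.

Lemma even_coef_odd (a : nat -> R) (j : nat) : even_coef a (S (2 * j)) = 0.
Proof. unfold even_coef. now rewrite Nat.even_succ, Nat.odd_mul. Qed.

Lemma parity_cases (n : nat) : exists j, n = (2 * j)%nat \/ n = S (2 * j).
Proof.
  destruct (Nat.Even_or_Odd n) as [[j ->]|[j ->]]; exists j; [left|right]; lia.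
Qed.

Lemma CPS_split (c : nat -> R) (a b : nat -> R) (z : C) :
  entire c -> entire a -> entire b ->
  (forall j, c (2 * j)%nat = a j) -> (forall j, c (S (2 * j)) = b j) ->
  CPS c z = (CPS a (z ^ 2) + z * CPS b (z ^ 2))%C.
Proof.
  intros Hc Ha Hb He Ho.
  assert (E1 : forall j, (RtoC (c (2 * j)%nat) * z ^ (2 * j))%C = (RtoC (a j) * (z ^ 2) ^ j)%C).
  { intros j. now rewrite He, Cpow_mult_r. }
  assert (E2 : forall j, (RtoC (c (S (2 * j))) * z ^ S (2 * j))%C
      = (z * (RtoC (b j) * (z ^ 2) ^ j))%C).
  { intros j. rewrite Ho, Cpow_S, Cpow_mult_r. ring. }
  unfold CPS. rewrite CSeries_even_odd.
  - rewrite (CSeries_ext _ _ E1), (CSeries_ext _ _ E2), CSeries_scal; [reflexivity|].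
    now apply CPS_summable.
  - now apply CPS_summable.
  - apply (ex_series_ext (fun j => Cmod (RtoC (a j) * (z ^ 2) ^ j)%C)).
    + intros j. now rewrite E1.
    + now apply (CPS_summable a (z ^ 2)).
  - apply (ex_series_ext (fun j => Cmod (z * (RtoC (b j) * (z ^ 2) ^ j))%C)).
    + intros j. now rewrite E2.
    + apply (abs_summable_scal z). now apply (CPS_summable b (z ^ 2)).
Qed.

Lemma entire_zero : entire (fun _ => 0).
Proof. apply CV_radius_const_0. Qed.

Lemma CPS_zero (z : C) : CPS (fun _ => 0) z = 0.
Proof.
  unfold CPS. rewrite (CSeries_ext _ (fun _ => (0 * 0)%C)) by (intros; ring).
  rewrite CSeries_scal; [ring|]. apply (CSeries_finite _ 0). auto.
Qed.

Lemma CPS_even (a : nat -> R) (z : C) : entire a -> entire (even_coef a) ->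
  CPS (even_coef a) z = CPS a (z ^ 2).
Proof.
  intros Ha He. rewrite (CPS_split _ a (fun _ => 0)); auto.
  - rewrite CPS_zero. ring.
  - apply entire_zero.
  - apply even_coef_even.
  - apply even_coef_odd.
Qed.

Definition struve_dv_coef (s : R) : nat -> R := even_coef (beta_cos_coef s).
Definition struve_v_coef (s : R) : nat -> R := PS_Int (struve_dv_coef s).

Lemma entire_struve_dv (s : R) : 0 <= s -> entire (struve_dv_coef s).
Proof.
  intros Hs. apply entire_of_le_inv_fact. intros n. unfold struve_dv_coef.
  destruct (parity_cases n) as [j [-> | ->]].
  - rewrite even_coef_even. now apply beta_cos_coef_abs.
  - rewrite even_coef_odd, Rabs_R0. left. apply Rinv_0_lt_compat, INR_fact_lt_0.
Qed.

Lemma entire_struve_v (s : R) : 0 <= s -> entire (struve_v_coef s).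
Proof.
  intros Hs. unfold entire, struve_v_coef. rewrite CV_radius_Int. now apply entire_struve_dv.
Qed.

Lemma entire_derive (a : nat -> R) : entire a -> entire (PS_derive a).
Proof. intros H. unfold entire. now rewrite CV_radius_derive. Qed.

Lemma beta_sinc_coef_eq (s : R) (j : nat) :
  beta_sinc_coef s j = beta_cos_coef s j / INR (S (2 * j)).
Proof.
  unfold beta_sinc_coef, sinc_coef, beta_cos_coef.
  replace (2 * j + 1)%nat with (S (2 * j)) by lia.
  rewrite fact_simpl, mult_INR. pose proof (INR_fact_neq_0 (2 * j)).
  assert (INR (S (2 * j)) <> 0) by (apply not_0_INR; lia). field. auto.
Qed.

Lemma entire_beta_sinc (s : R) : 0 <= s -> entire (beta_sinc_coef s).
Proof.
  intros Hs. apply entire_of_le_inv_fact. intros j. unfold beta_sinc_coef.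
  rewrite Rabs_mult, sinc_coef_abs. destruct (beta_moment_bounds s j Hs).
  rewrite (Rabs_pos_eq (beta_moment s j)) by lra.
  assert (/ INR (fact (2 * j + 1)) <= / INR (fact j)).
  { apply Rinv_le_contravar; [apply INR_fact_lt_0|]. apply le_INR, fact_le. lia. }
  pose proof (Rinv_0_lt_compat _ (INR_fact_lt_0 (2 * j + 1))). nra.
Qed.

Lemma CPS_struve_v (s : R) (z : C) : 0 <= s ->
  CPS (struve_v_coef s) z = (z * CPS (beta_sinc_coef s) (z ^ 2))%C.
Proof.
  intros Hs. rewrite (CPS_split _ (fun _ => 0) (beta_sinc_coef s)).
  - rewrite CPS_zero. ring.
  - now apply entire_struve_v.
  - apply entire_zero.
  - now apply entire_beta_sinc.
  - intros [|j]; [reflexivity|].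
    replace (2 * S j)%nat with (S (S (2 * j))) by lia.
    unfold struve_v_coef, PS_Int, struve_dv_coef. rewrite even_coef_odd. unfold Rdiv. ring.
  - intros j. unfold struve_v_coef, PS_Int, struve_dv_coef.
    rewrite even_coef_even. symmetry. apply beta_sinc_coef_eq.
Qed.

Lemma pochhammer_pos (a : R) (n : nat) : 0 < a -> 0 < pochhammer a n.
Proof.
  intros Ha. induction n as [|n IH]; simpl; [lra|]. pose proof (pos_INR n).
  apply Rmult_lt_0_compat; lra.
Qed.

Lemma pochhammer_1 (n : nat) : pochhammer 1 n = INR (fact n).
Proof.
  induction n as [|n IH]; [reflexivity|]. cbn [pochhammer].
  rewrite IH, fact_simpl, mult_INR, S_INR. ring.
Qed.

Lemma pochhammer_3_2 (n : nat) :
  pochhammer (3 / 2) n * 4 ^ n * INR (fact n) = INR (fact (2 * n + 1)).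
Proof.
  induction n as [|n IH]; [simpl; ring|].
  replace (2 * S n + 1)%nat with (S (S (2 * n + 1))) by lia.
  rewrite !fact_simpl, !mult_INR, <- IH, !S_INR, plus_INR, mult_INR.
  cbn [pochhammer pow]. simpl INR. field.
Qed.

Lemma pochhammer_beta_moment (s : R) (n : nat) : 0 <= s ->
  beta_moment s n * pochhammer (s + 1) n = INR (fact n).
Proof.
  intros Hs. induction n as [|n IH]; [simpl; ring|].
  cbn [pochhammer beta_moment]. rewrite fact_simpl, mult_INR, <- IH, S_INR.
  pose proof (pos_INR n). field. lra.
Qed.

Lemma hypergeometric_beta_sinc (s : R) (z : C) : 0 <= s ->
  hypergeometric_1F2 1 (3 / 2) (s + 1) (- (z ^ 2 / 4)) = CPS (beta_sinc_coef s) (z ^ 2).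
Proof.
  intros Hs. unfold hypergeometric_1F2, CPS. apply CSeries_ext. intros n.
  replace (- (z ^ 2 / 4))%C with (RtoC (- / 4) * z ^ 2)%C
    by (rewrite RtoC_opp, RtoC_inv; [field|]; (lra || (intros E; apply RtoC_inj in E; lra))).
  rewrite Cpow_mult_l, <- RtoC_pow, Cmult_assoc, <- RtoC_mult. f_equal. f_equal.
  rewrite pochhammer_1. unfold beta_sinc_coef, sinc_coef. rewrite <- pochhammer_3_2.
  pose proof (pochhammer_pos (3 / 2) n ltac:(lra)).
  pose proof (pochhammer_pos (s + 1) n ltac:(lra)).
  pose proof (INR_fact_neq_0 n). pose proof (pow_lt 4 n ltac:(lra)).
  replace (beta_moment s n) with (INR (fact n) / pochhammer (s + 1) n)
    by (rewrite <- (pochhammer_beta_moment s n Hs); field; lra).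
  replace (- / 4) with (-1 * / 4) by field. rewrite Rpow_mult_distr, pow_inv.
  field. repeat split; try lra.
Qed.

Lemma struve_v_CPS (nu : R) (z : C) : 0 <= nu + / 2 ->
  struve_v nu z = CPS (struve_v_coef (nu + / 2)) z.
Proof.
  intros Hs. rewrite CPS_struve_v, <- hypergeometric_beta_sinc by auto.
  unfold struve_v. now replace (nu + 3 / 2) with (nu + / 2 + 1) by field.
Qed.

Lemma PS_derive_Int (a : nat -> R) (n : nat) : PS_derive (PS_Int a) n = a n.
Proof.
  unfold PS_derive, PS_Int. assert (INR (S n) <> 0) by (now apply not_0_INR). field. auto.
Qed.

Lemma CPS_ext (a b : nat -> R) (z : C) : (forall n, a n = b n) -> CPS a z = CPS b z.
Proof. intros H. unfold CPS. apply CSeries_ext. intros n. now rewrite H. Qed.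

Lemma C_derive_struve_v (nu : R) (z : C) : 0 <= nu + / 2 ->
  C_derive (struve_v nu) z = CPS (struve_dv_coef (nu + / 2)) z.
Proof.
  intros Hs. rewrite (C_derive_ext _ (CPS (struve_v_coef (nu + / 2))))
    by (intros; now apply struve_v_CPS).
  rewrite C_derive_CPS by now apply entire_struve_v.
  apply CPS_ext. intros n. apply PS_derive_Int.
Qed.

Lemma C_derive_2_struve_v (nu : R) (z : C) : 0 <= nu + / 2 ->
  C_derive (C_derive (struve_v nu)) z = CPS (PS_derive (struve_dv_coef (nu + / 2))) z.
Proof.
  intros Hs. rewrite (C_derive_ext _ (CPS (struve_dv_coef (nu + / 2))))
    by (intros; now apply C_derive_struve_v).
  now rewrite C_derive_CPS by now apply entire_struve_dv.
Qed.

Lemma CPS_struve_dv (s : R) (z : C) : 0 <= s ->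
  CPS (struve_dv_coef s) z = CPS (beta_cos_coef s) (z ^ 2).
Proof.
  intros Hs. apply CPS_even; [now apply entire_beta_cos|now apply entire_struve_dv].
Qed.

Lemma CPS_struve_ddv (s : R) (z : C) : 0 <= s ->
  (z * CPS (PS_derive (struve_dv_coef s)) z)%C
  = (2 * CPS (euler_coef (beta_cos_coef s)) (z ^ 2))%C.
Proof.
  intros Hs. set (a := beta_cos_coef s).
  assert (Hd : entire (struve_dv_coef s)) by now apply entire_struve_dv.
  assert (Hb : entire (euler_coef a)) by now apply entire_euler_beta_cos.
  destruct (CPS_derive_reindex _ z Hd) as [Hsum <-].
  rewrite <- CSeries_scal by auto.
  assert (H2 : entire (fun j => 2 * euler_coef a j)).
  { unfold entire. rewrite <- Hb. apply (CV_radius_scal 2). lra. }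
  assert (Hterm : forall n, (z * (RtoC (struve_dv_coef s n) * (RtoC (INR n) * z ^ pred n)))%C
     = (RtoC (euler_coef (struve_dv_coef s) n) * z ^ n)%C).
  { intros [|n]; unfold euler_coef; rewrite RtoC_mult; simpl pred; [simpl; ring|].
    rewrite Cpow_S. ring. }
  rewrite (CSeries_ext _ _ Hterm).
  assert (He : forall n, euler_coef (struve_dv_coef s) n = even_coef (fun j => 2 * euler_coef a j) n).
  { intros n. unfold euler_coef, struve_dv_coef. destruct (parity_cases n) as [j [-> | ->]].
    - rewrite !even_coef_even, mult_INR. simpl (INR 2). fold a. ring.
    - rewrite !even_coef_odd. ring. }
  change (CPS (euler_coef (struve_dv_coef s)) z = (2 * CPS (euler_coef a) (z ^ 2))%C).
  rewrite (CPS_ext _ _ z He), CPS_even; auto.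
  - unfold CPS. rewrite <- CSeries_scal by now apply (CPS_summable (euler_coef a)).
    apply CSeries_ext. intros n. rewrite RtoC_mult. ring.
  - assert (Hent : entire (euler_coef (struve_dv_coef s))).
    { unfold entire. rewrite <- (entire_derive _ Hd), <- (CV_radius_incr_1 (PS_derive _)).
      apply CV_radius_ext. intros [|n]; unfold euler_coef, PS_incr_1, PS_derive; simpl; [|reflexivity].
      apply Rmult_0_l. }
    unfold entire in *. rewrite <- Hent. symmetry. apply CV_radius_ext. exact He.
Qed.

Lemma conv_radius_struve_v (nu : R) : 0 <= nu + / 2 -> conv_radius (struve_v nu) = p_infty.
Proof.
  intros Hs. unfold conv_radius.
  destruct (Lub_Rbar_correct (fun r => 0 < r /\
    exists a : nat -> C, forall z : C, Cmod z < r ->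
      @is_pseries C_AbsRing C_NormedModule a z (struve_v nu z))) as [Hub _].
  assert (Hall : forall r, 0 < r -> Rbar_le r (Lub_Rbar (fun r => 0 < r /\
    exists a : nat -> C, forall z : C, Cmod z < r ->
      @is_pseries C_AbsRing C_NormedModule a z (struve_v nu z)))).
  { intros r Hr. apply Hub. split; auto. exists (fun n => RtoC (struve_v_coef (nu + / 2) n)).
    intros z _. rewrite struve_v_CPS by auto. now apply CPS_pseries, entire_struve_v. }
  destruct (Lub_Rbar _) as [l| |]; auto.
  - specialize (Hall (Rabs l + 1)). pose proof (Rle_abs l). pose proof (Rabs_pos l).
    simpl in Hall. specialize (Hall ltac:(lra)). lra.
  - specialize (Hall 1 ltac:(lra)). contradiction.
Qed.

(** * The Struve function on the positive half-line *)

Lemma entire_is_derive (a : nat -> R) (x : R) : entire a ->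
  is_derive (PSeries a) x (PSeries (PS_derive a) x).
Proof. intros H. apply is_derive_PSeries. rewrite H. exact I. Qed.

Lemma is_derive_struve_v (s x : R) : 0 <= s ->
  is_derive (PSeries (struve_v_coef s)) x (PSeries (struve_dv_coef s) x).
Proof.
  intros Hs. rewrite <- (PSeries_ext (PS_derive (struve_v_coef s)) (struve_dv_coef s)).
  - now apply entire_is_derive, entire_struve_v.
  - intros n. apply PS_derive_Int.
Qed.

Lemma PSeries_struve_v (s x : R) : 0 <= s ->
  PSeries (struve_v_coef s) x = x * PSeries (beta_sinc_coef s) (x ^ 2).
Proof.
  intros Hs. apply RtoC_inj.
  now rewrite RtoC_mult, <- !CPS_RtoC, RtoC_pow, CPS_struve_v.
Qed.

Lemma PSeries_struve_dv (s x : R) : 0 <= s ->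
  PSeries (struve_dv_coef s) x = PSeries (beta_cos_coef s) (x ^ 2).
Proof.
  intros Hs. apply RtoC_inj. now rewrite <- !CPS_RtoC, RtoC_pow, CPS_struve_dv.
Qed.

Lemma PSeries_struve_ddv (s x : R) : 0 <= s ->
  x * PSeries (PS_derive (struve_dv_coef s)) x
  = 2 * PSeries (euler_coef (beta_cos_coef s)) (x ^ 2).
Proof.
  intros Hs. apply RtoC_inj. rewrite !RtoC_mult, <- !CPS_RtoC, RtoC_pow. now apply CPS_struve_ddv.
Qed.

(** On the positive half-line H_nu is this factor times v.  It is a constant multiple of
    x^nu, so its logarithmic derivative is nu / x. *)
Definition struve_factor (nu x : R) : R :=
  Rpower (x / 2) (nu + 1) / (sqrt (PI / 4) * Gamma (nu + 3 / 2)) / x.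

Lemma struve_constant_pos (nu : R) : Rabs nu <= 1 / 2 ->
  0 < sqrt (PI / 4) * Gamma (nu + 3 / 2).
Proof.
  intros H. apply Rabs_le_between in H. pose proof PI_RGT_0.
  apply Rmult_lt_0_compat; [apply sqrt_lt_R0; lra|apply Gamma_positive; lra].
Qed.

Lemma struve_factor_pos (nu x : R) : Rabs nu <= 1 / 2 -> 0 < x -> 0 < struve_factor nu x.
Proof.
  intros H Hx. pose proof (struve_constant_pos nu H). unfold struve_factor.
  repeat apply Rdiv_lt_0_compat; auto. apply exp_pos.
Qed.

Lemma struve_real (nu x : R) : Rabs nu <= 1 / 2 -> 0 < x ->
  struve nu (RtoC x) = RtoC (struve_factor nu x * PSeries (struve_v_coef (nu + / 2)) x).
Proof.
  intros H Hx. pose proof (struve_constant_pos nu H) as Hk.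
  apply Rabs_le_between in H. assert (Hs : 0 <= nu + / 2) by lra.
  unfold struve. replace (nu + 3 / 2) with (nu + / 2 + 1) at 2 by field.
  rewrite hypergeometric_beta_sinc, <- RtoC_pow, CPS_RtoC by auto.
  rewrite PSeries_struve_v by auto.
  replace (RtoC x / 2)%C with (RtoC (x / 2)) by (rewrite RtoC_div; [reflexivity|lra]).
  unfold Cpower. destruct (Ceq_dec (RtoC (x / 2)) 0) as [E|E].
  { apply RtoC_inj in E. lra. }
  assert (Ha : Carg (RtoC (x / 2)) = 0).
  { unfold Carg. simpl. destruct (Req_EM_T 0 0) as [_|n]; [|now destruct n].
    destruct (Rlt_dec (x / 2) 0); [lra|reflexivity]. }
  rewrite Ha, Rmult_0_r, cos_0, sin_0, Cmod_R, Rabs_pos_eq by lra.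
  change (1, 0) with (RtoC 1). rewrite <- RtoC_mult, <- RtoC_div, <- RtoC_mult by lra.
  f_equal. unfold struve_factor. field.
  apply Rgt_not_eq in Hk. repeat split; try lra; intros E0; apply Hk; rewrite E0; ring.
Qed.

Lemma is_derive_struve_factor (nu x : R) : Rabs nu <= 1 / 2 -> 0 < x ->
  is_derive (struve_factor nu) x (nu / x * struve_factor nu x).
Proof.
  intros H Hx. pose proof (struve_constant_pos nu H) as Hk.
  unfold struve_factor. set (K := sqrt (PI / 4) * Gamma (nu + 3 / 2)) in *.
  unfold Rpower. auto_derive; [repeat split; lra|]. unfold Rdiv.
  field. lra.
Qed.

Lemma locally_pos (x : R) : 0 < x -> locally x (fun t => 0 < t).
Proof. intros H. exact (open_gt 0 x H). Qed.

Definition struve_real_derivative (nu x : R) : R :=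
  struve_factor nu x * (nu / x * PSeries (struve_v_coef (nu + / 2)) x
                        + PSeries (struve_dv_coef (nu + / 2)) x).

Lemma C_derive_struve (nu x : R) : Rabs nu <= 1 / 2 -> 0 < x ->
  C_derive (struve nu) (RtoC x) = RtoC (struve_real_derivative nu x).
Proof.
  intros H Hx. assert (Hs : 0 <= nu + / 2) by (apply Rabs_le_between in H; lra).
  apply (C_derive_real _ (fun t => struve_factor nu t * PSeries (struve_v_coef (nu + / 2)) t)).
  - generalize (locally_pos x Hx). apply filter_imp. intros t Ht. now apply struve_real.
  - pose proof (is_derive_struve_factor nu x H Hx) as D1.
    pose proof (is_derive_struve_v (nu + / 2) x Hs) as D2.
    pose proof (is_derive_mult _ _ _ _ _ D1 D2 Rmult_comm) as D.
    match type of D with is_derive _ _ ?l =>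
      replace (struve_real_derivative nu x) with l; [exact D|] end.
    unfold struve_real_derivative, plus, mult; simpl. ring.
Qed.

Lemma C_derive_2_struve (nu x : R) : Rabs nu <= 1 / 2 -> 0 < x ->
  C_derive (C_derive (struve nu)) (RtoC x) = RtoC (struve_factor nu x *
    (nu / x * (nu / x * PSeries (struve_v_coef (nu + / 2)) x + PSeries (struve_dv_coef (nu + / 2)) x)
     - nu / x ^ 2 * PSeries (struve_v_coef (nu + / 2)) x
     + nu / x * PSeries (struve_dv_coef (nu + / 2)) x
     + PSeries (PS_derive (struve_dv_coef (nu + / 2))) x)).
Proof.
  intros H Hx. assert (Hs : 0 <= nu + / 2) by (apply Rabs_le_between in H; lra).
  apply (C_derive_real _ (struve_real_derivative nu)).
  - generalize (locally_pos x Hx). apply filter_imp. intros t Ht. now apply C_derive_struve.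
  - pose proof (is_derive_struve_factor nu x H Hx) as D1.
    pose proof (is_derive_struve_v (nu + / 2) x Hs) as D2.
    pose proof (entire_is_derive _ x (entire_struve_dv (nu + / 2) Hs)) as D3.
    assert (D4 : is_derive (fun t => nu / t) x (- nu / x ^ 2)) by (auto_derive; [lra|field; lra]).
    pose proof (is_derive_mult _ _ _ _ _ D4 D2 Rmult_comm) as D5.
    pose proof (is_derive_plus _ _ _ _ _ D5 D3) as D6.
    pose proof (is_derive_mult _ _ _ _ _ D1 D6 Rmult_comm) as D.
    unfold struve_real_derivative.
    match type of D with is_derive _ _ ?l => match goal with |- is_derive _ _ ?l' =>
      replace l' with l; [exact D|] end end.
    unfold plus, mult; simpl. field. lra.
Qed.

(** The left side of the equation multiplied by v'(x); it is defined and continuous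
    everywhere. *)
Definition convexity_gap (nu alpha beta x : R) : R :=
  (1 - alpha) * PSeries (beta_cos_coef (nu + / 2)) (x ^ 2)
  + (1 + beta) * (2 * PSeries (euler_coef (beta_cos_coef (nu + / 2))) (x ^ 2)).

Lemma struve_denominator_real (nu x : R) : Rabs nu <= 1 / 2 -> 0 < x ->
  struve_denominator nu (RtoC x)
  = RtoC (struve_factor nu x * (x * PSeries (beta_cos_coef (nu + / 2)) (x ^ 2))).
Proof.
  intros H Hx. assert (Hs : 0 <= nu + / 2) by (apply Rabs_le_between in H; lra).
  unfold struve_denominator. rewrite struve_real, C_derive_struve by auto.
  rewrite <- RtoC_opp, <- !RtoC_mult, <- RtoC_plus. f_equal.
  unfold struve_real_derivative. rewrite <- PSeries_struve_dv by auto. field. lra.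
Qed.

Lemma uniform_convexity_root_iff (nu alpha beta x : R) : Rabs nu <= 1 / 2 -> 0 < x ->
  uniform_convexity_root nu alpha beta x <->
  PSeries (beta_cos_coef (nu + / 2)) (x ^ 2) <> 0 /\ convexity_gap nu alpha beta x = 0.
Proof.
  intros H Hx. assert (Hs : 0 <= nu + / 2) by (apply Rabs_le_between in H; lra).
  pose proof (struve_factor_pos nu x H Hx) as Hf.
  unfold uniform_convexity_root. rewrite struve_denominator_real by auto.
  set (G := PSeries (beta_cos_coef (nu + / 2)) (x ^ 2)).
  assert (Hden : RtoC (struve_factor nu x * (x * G)) <> 0 <-> G <> 0).
  { split; intros Hne E; apply Hne.
    - rewrite E. f_equal. ring.
    - apply RtoC_inj in E. apply Rmult_integral in E as [E|E]; [lra|].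
      apply Rmult_integral in E as [E|E]; lra. }
  rewrite Hden.
  assert (Hiff : G <> 0 ->
    (((1 - RtoC alpha) - (1 + RtoC beta) *
    (1 + RtoC nu - RtoC x *
      (((1 - RtoC nu) * C_derive (struve nu) x
        + RtoC x * C_derive (C_derive (struve nu)) x)
       / RtoC (struve_factor nu x * (x * G)))))%C
    = RtoC (convexity_gap nu alpha beta x / G))).
  { intros HG. rewrite C_derive_struve, C_derive_2_struve by auto.
    assert (Hne : struve_factor nu x * (x * G) <> 0).
    { intros E. apply (proj2 Hden HG). now rewrite E. }
    (* With the values of the derivatives as opaque reals, the complex expression is the
       image of a real one. *)
    assert (Hcast : forall A B D : R, D <> 0 ->
      ((1 - RtoC alpha) - (1 + RtoC beta) * (1 + RtoC nu - RtoC x *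
        (((1 - RtoC nu) * RtoC A + RtoC x * RtoC B) / RtoC D)))%C
      = RtoC (1 - alpha - (1 + beta) * (1 + nu - x * (((1 - nu) * A + x * B) / D)))).
    { intros A B D HD. repeat (rewrite RtoC_minus || rewrite RtoC_mult || rewrite RtoC_plus
        || (rewrite RtoC_div by exact HD)). reflexivity. }
    rewrite Hcast by auto.
    f_equal. unfold convexity_gap. fold G. rewrite <- PSeries_struve_ddv by auto.
    unfold struve_real_derivative. rewrite (PSeries_struve_dv _ x Hs). fold G.
    field. repeat split; lra. }
  split; intros [HG E]; split; auto; rewrite Hiff in * by auto.
  - apply RtoC_inj in E. apply Rmult_integral in E as [E|E]; auto.
    exfalso. revert E. now apply Rinv_neq_0_compat.
  - rewrite E. f_equal. unfold Rdiv. ring.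
Qed.

(** * First zeros and the radii *)

(** The supremum of the t such that [f] is positive on [0, t]. *)
Lemma first_zero (f : R -> R) (b : R) : continuity f -> 0 < f 0 -> 0 < b -> f b <= 0 ->
  exists r, 0 < r <= b /\ f r = 0 /\ forall x, 0 <= x < r -> 0 < f x.
Proof.
  intros Hc H0 Hb Hfb.
  set (E := fun t => 0 <= t <= b /\ forall x, 0 <= x <= t -> 0 < f x).
  destruct (completeness E) as [r [Hub Hlub]].
  { exists b. intros t [Ht _]. lra. }
  { exists 0. split; [lra|]. intros x Hx. now replace x with 0 by lra. }
  assert (Hr0 : 0 <= r).
  { apply Hub. split; [lra|]. intros x Hx. now replace x with 0 by lra. }
  assert (Hrb : r <= b) by (apply Hlub; intros t [Ht _]; lra).
  assert (Hpos : forall x, 0 <= x < r -> 0 < f x).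
  { intros x Hx. destruct (Classical_Prop.classic (exists t, E t /\ x < t)) as [[t [[Ht1 Ht2] Hxt]]|Hn].
    - apply Ht2. lra.
    - exfalso. assert (r <= x); [|lra]. apply Hlub. intros t Ht.
      destruct (Rle_lt_dec t x); auto. exfalso. apply Hn. now exists t. }
  assert (Hnear : forall e, 0 < e -> exists d, 0 < d /\ forall x, Rabs (x - r) < d -> Rabs (f x - f r) < e).
  { intros e He. destruct (Hc r e He) as [d [Hd Hd']]. exists d. split; auto.
    intros x Hx. destruct (Req_dec x r) as [->|Hne].
    - rewrite Rminus_diag, Rabs_R0. auto.
    - apply Hd'. split; auto. split; [exact I|auto]. }
  assert (Hfr : f r = 0).
  { destruct (Rtotal_order (f r) 0) as [Hlt|[Heq|Hgt]]; auto; exfalso.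
    - destruct (Hnear (- f r) ltac:(lra)) as [d [Hd Hd']].
      assert (Hrp : 0 < r) by (destruct Hr0 as [|<-]; lra).
      set (x := Rmax 0 (r - d / 2)).
      assert (Hx : 0 <= x < r /\ r - d / 2 <= x).
      { unfold x. split; [split|]; [apply Rmax_l|apply Rmax_lub_lt; lra|apply Rmax_r]. }
      specialize (Hpos x ltac:(lra)). specialize (Hd' x ltac:(apply Rabs_def1; lra)).
      apply Rabs_def2 in Hd'. lra.
    - destruct (Hnear (f r) Hgt) as [d [Hd Hd']].
      assert (Hrb' : r < b) by (destruct Hrb as [|E0]; auto; rewrite E0 in Hgt; lra).
      set (t := Rmin b (r + d / 2)).
      assert (Ht : r < t /\ t <= b /\ t <= r + d / 2).
      { unfold t. split; [apply Rmin_glb_lt; lra|]. split; [apply Rmin_l|apply Rmin_r]. }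
      assert (HE : E t).
      { split; [lra|]. intros x Hx. destruct (Rlt_le_dec x r); [apply Hpos; lra|].
        specialize (Hd' x ltac:(apply Rabs_def1; lra)). apply Rabs_def2 in Hd'. lra. }
      apply Hub in HE. lra. }
  exists r. repeat split; auto. destruct Hr0 as [|<-]; auto. lra.
Qed.

Lemma continuity_PSeries_sqr (a : nat -> R) : entire a -> continuity (fun x => PSeries a (x ^ 2)).
Proof.
  intros H. apply (continuity_comp (fun x => x ^ 2) (PSeries a)).
  - apply derivable_continuous, derivable_pow.
  - now apply entire_continuity.
Qed.

Lemma continuity_convexity_gap (nu alpha beta : R) : 0 <= nu + / 2 ->
  continuity (convexity_gap nu alpha beta).
Proof.
  intros Hs. unfold convexity_gap.
  apply (continuity_plus (fun x => (1 - alpha) * PSeries (beta_cos_coef (nu + / 2)) (x ^ 2))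
    (fun x => (1 + beta) * (2 * PSeries (euler_coef (beta_cos_coef (nu + / 2))) (x ^ 2)))).
  - apply (continuity_scal (fun x => PSeries (beta_cos_coef (nu + / 2)) (x ^ 2))).
    now apply continuity_PSeries_sqr, entire_beta_cos.
  - apply (continuity_scal (fun x => 2 * PSeries (euler_coef (beta_cos_coef (nu + / 2))) (x ^ 2))).
    apply (continuity_scal (fun x => PSeries (euler_coef (beta_cos_coef (nu + / 2))) (x ^ 2))).
    now apply continuity_PSeries_sqr, entire_euler_beta_cos.
Qed.

Lemma convexity_gap_0 (nu alpha beta : R) : convexity_gap nu alpha beta 0 = 1 - alpha.
Proof.
  unfold convexity_gap. replace (0 ^ 2) with 0 by ring. rewrite !PSeries_0.
  unfold euler_coef, beta_cos_coef. simpl. field.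
Qed.

Lemma rolle_between (f df : R -> R) (a b : R) : a < b ->
  (forall x, is_derive f x (df x)) -> f a = f b -> exists c, a < c < b /\ df c = 0.
Proof.
  intros Hab Hd Hf.
  destruct (MVT_cor2 f df a b Hab) as [c [Hc1 Hc2]].
  { intros c _. apply is_derive_Reals, Hd. }
  exists c. split; auto. rewrite Hf, Rminus_diag in Hc1.
  symmetry in Hc1. apply Rmult_integral in Hc1 as [E|E]; lra.
Qed.

Lemma convexity_quotient_struve_v (nu : R) (z : C) : 0 <= nu + / 2 ->
  convexity_quotient (struve_v nu) z
  = (2 * CPS (euler_coef (beta_cos_coef (nu + / 2))) (z ^ 2)
     / CPS (beta_cos_coef (nu + / 2)) (z ^ 2))%C.
Proof.
  intros Hs. unfold convexity_quotient.
  rewrite C_derive_2_struve_v, C_derive_struve_v, CPS_struve_ddv, CPS_struve_dv by auto.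
  reflexivity.
Qed.

(** Inside the disc of radius r0 the condition holds by [beta_cos_bounds] applied with
    r = |z|^2.  At the point r0 itself it becomes an equality, so no larger disc qualifies. *)
Lemma radius_of_uniform_convexity_struve_v (nu alpha beta r0 : R) :
  Rabs nu <= 1 / 2 -> 0 <= beta -> alpha < 1 -> 0 < r0 ->
  (forall x, 0 <= x <= r0 -> 0 < PSeries (beta_cos_coef (nu + / 2)) (x ^ 2)) ->
  (forall x, 0 <= x < r0 -> 0 < convexity_gap nu alpha beta x) ->
  convexity_gap nu alpha beta r0 = 0 ->
  radius_of_uniform_convexity beta alpha (struve_v nu) = Finite r0.
Proof.
  intros H Hbeta Halpha Hr0 HG Hgap Hroot. apply Rabs_le_between in H.
  set (s := nu + / 2) in *. assert (Hs : 0 <= s <= 1) by (unfold s; lra).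
  apply is_lub_Rbar_unique. rewrite conv_radius_struve_v by (fold s; lra).
  split.
  - intros r [Hr [_ Hz]]. simpl. destruct (Rle_lt_dec r r0) as [Hle|Hlt]; auto. exfalso.
    assert (Hm : Cmod (RtoC r0) < r) by (rewrite Cmod_R, Rabs_pos_eq; lra).
    destruct (Hz _ Hm) as [_ Hcv].
    rewrite convexity_quotient_struve_v in Hcv by (fold s; lra). fold s in Hcv.
    rewrite <- RtoC_pow, !CPS_RtoC in Hcv.
    specialize (HG r0 ltac:(lra)). unfold convexity_gap in Hroot. fold s in Hroot.
    set (G := PSeries (beta_cos_coef s) (r0 ^ 2)) in *.
    set (E := PSeries (euler_coef (beta_cos_coef s)) (r0 ^ 2)) in *.
    rewrite <- RtoC_mult, <- RtoC_div, <- RtoC_plus, Cmod_R in Hcv by lra. simpl in Hcv.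
    assert (Hq : (1 + beta) * (2 * E / G) = - (1 - alpha)).
    { apply Rmult_eq_reg_r with G; [|lra].
      transitivity ((1 + beta) * (2 * E)); [field; lra|lra]. }
    set (q := 2 * E / G) in *.
    assert (q <= 0) by nra. rewrite Rabs_left1 in Hcv by auto. nra.
  - intros l Hl. apply Hl. split; auto. split; [exact I|].
    intros z Hz. pose proof (Cmod_ge_0 z) as Hz0.
    set (x := Cmod z) in *.
    assert (HGx : forall y, 0 <= y <= x ^ 2 -> 0 < PSeries (beta_cos_coef s) y).
    { intros y Hy. replace y with ((sqrt y) ^ 2) by (apply pow2_sqrt; lra). apply HG.
      split; [apply sqrt_pos|]. apply Rle_trans with x; [|lra].
      rewrite <- (sqrt_pow2 x) by lra. apply sqrt_le_1_alt. lra. }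
    destruct (beta_cos_bounds s (x ^ 2) (z ^ 2) Hs HGx) as [B1 B2].
    { rewrite Cmod_pow. apply Rle_refl. }
    specialize (Hgap x ltac:(lra)). unfold convexity_gap in Hgap. fold s in Hgap.
    pose proof (HGx (x ^ 2) ltac:(split; [apply pow2_ge_0|lra])) as HGp.
    rewrite C_derive_struve_v, CPS_struve_dv by (fold s; lra). fold s.
    rewrite convexity_quotient_struve_v by (fold s; lra). fold s.
    set (G := PSeries (beta_cos_coef s) (x ^ 2)) in *.
    set (E := PSeries (euler_coef (beta_cos_coef s)) (x ^ 2)) in *.
    set (Gz := CPS (beta_cos_coef s) (z ^ 2)) in *.
    set (Ez := CPS (euler_coef (beta_cos_coef s)) (z ^ 2)) in *.
    assert (HGz : Gz <> 0) by (apply Cmod_gt_0; lra).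
    split; [exact HGz|].
    set (q := (2 * Ez / Gz)%C).
    assert (Hq : Cmod q * G <= - (2 * E)).
    { unfold q. rewrite Cmod_div, Cmod_mult, Cmod_R, Rabs_pos_eq by (auto; lra).
      apply Rmult_le_reg_r with (Cmod Gz); [lra|].
      replace (2 * Cmod Ez / Cmod Gz * G * Cmod Gz) with (2 * (Cmod Ez * G)) by (field; lra).
      lra. }
    assert (Hre : Re (1 + q)%C >= 1 - Cmod q).
    { change (Re (1 + q)%C) with (1 + Re q). pose proof (re_le_Cmod q) as Hr.
      apply Rabs_le_between in Hr. lra. }
    assert (Hfin : (1 + beta) * Cmod q < 1 - alpha).
    { apply Rmult_lt_reg_r with G; auto. nra. }
    lra.
Qed.

Lemma radius_of_convexity_eq (f : C -> C) :
  radius_of_convexity f = radius_of_uniform_convexity 0 0 f.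
Proof.
  apply Lub_Rbar_eqset. intros r. split; intros [H1 [H2 H3]]; split; auto; split; auto;
    intros z Hz; destruct (H3 z Hz) as [H4 H5]; split; auto; lra.
Qed.

Theorem theorem2p5 (nu alpha beta : R)
  (hnu : Rabs nu <= 1 / 2) (halpha : 0 <= alpha < 1) (hbeta : 0 <= beta) :
  (exists r : R,
     radius_of_uniform_convexity beta alpha (struve_v nu) = Finite r /\
     is_smallest_positive (uniform_convexity_root nu alpha beta) r) /\
  (exists h s : R,
     is_smallest_positive (fun x => struve nu x = 0) h /\
     is_smallest_positive (fun x => C_derive (struve_v nu) x = 0) s /\
     Rbar_le (radius_of_uniform_convexity beta alpha (struve_v nu))
             (radius_of_convexity (struve_v nu)) /\
     (0 < alpha \/ 0 < beta ->
      Rbar_lt (radius_of_uniform_convexity beta alpha (struve_v nu))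
              (radius_of_convexity (struve_v nu))) /\
     Rbar_lt (radius_of_convexity (struve_v nu)) (Finite s) /\
     s < h).
Proof.
  assert (Hnu := hnu). apply Rabs_le_between in Hnu.
  set (m := nu + / 2). assert (Hm : 0 <= m <= 1) by (unfold m; lra).
  assert (Hm0 : 0 <= m) by lra. pose proof PI_RGT_0 as HPI.
  set (G := fun x => PSeries (beta_cos_coef m) (x ^ 2)).
  set (E := fun x => PSeries (euler_coef (beta_cos_coef m)) (x ^ 2)).
  set (F := fun x => PSeries (beta_sinc_coef m) (x ^ 2)).
  assert (HF0 : F 0 = 1).
  { unfold F. replace (0 ^ 2) with 0 by ring. rewrite PSeries_0.
    unfold beta_sinc_coef, sinc_coef. simpl. field. }
  assert (HG0 : G 0 = 1).
  { unfold G. replace (0 ^ 2) with 0 by ring. rewrite PSeries_0.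
    unfold beta_cos_coef. simpl. field. }
  destruct (first_zero F (2 * PI)) as [h [Hh [HFh HFpos]]].
  { now apply continuity_PSeries_sqr, entire_beta_sinc. }
  { lra. } { lra. } { now apply beta_sinc_nonpos. }
  destruct (rolle_between (PSeries (struve_v_coef m)) (PSeries (struve_dv_coef m)) 0 h)
    as [c [Hc Hdc]]; [lra|intros; now apply is_derive_struve_v|..].
  { rewrite !PSeries_struve_v by auto. fold (F 0) (F h). rewrite HFh. ring. }
  rewrite PSeries_struve_dv in Hdc by auto. fold (G c) in Hdc.
  destruct (first_zero G c) as [s [Hs [HGs HGpos]]]; [|lra..|].
  { now apply continuity_PSeries_sqr, entire_beta_cos. }
  destruct (rolle_between (fun x => x * PSeries (struve_dv_coef m) x)
     (convexity_gap nu 0 0) 0 s) as [xi [Hxi Hgxi]]; [lra|..].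
  { intros x.
    assert (D : is_derive (fun x => x * PSeries (struve_dv_coef m) x) x
       (1 * PSeries (struve_dv_coef m) x + x * PSeries (PS_derive (struve_dv_coef m)) x)).
    { apply (is_derive_mult (fun x => x) (PSeries (struve_dv_coef m))).
      - apply (is_derive_id (K := R_AbsRing)).
      - now apply entire_is_derive, entire_struve_dv.
      - apply Rmult_comm. }
    rewrite PSeries_struve_ddv, PSeries_struve_dv in D by auto.
    replace (convexity_gap nu 0 0 x) with
      (1 * PSeries (beta_cos_coef m) (x ^ 2) + 2 * PSeries (euler_coef (beta_cos_coef m)) (x ^ 2))
      by (unfold convexity_gap; fold m; ring).
    exact D. }
  { rewrite (PSeries_struve_dv m s) by auto. fold (G s). rewrite HGs. ring. }
  destruct (first_zero (convexity_gap nu 0 0) xi) as [rc [Hrc [Hgrc Hrcpos]]];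
    [now apply continuity_convexity_gap|rewrite convexity_gap_0; lra|lra|lra|].
  assert (HGrc : 0 < G rc) by (apply HGpos; lra).
  assert (Hgap : convexity_gap nu alpha beta rc = - (alpha + beta) * G rc).
  { unfold convexity_gap in Hgrc |- *. fold m in Hgrc |- *. unfold G.
    assert (E2 : 2 * PSeries (euler_coef (beta_cos_coef m)) (rc ^ 2)
       = - PSeries (beta_cos_coef m) (rc ^ 2)) by lra.
    rewrite E2. ring. }
  destruct (first_zero (convexity_gap nu alpha beta) rc) as [r0 [Hr0 [Hgr0 Hr0pos]]];
    [now apply continuity_convexity_gap|rewrite convexity_gap_0; lra|lra|rewrite Hgap; nra|].
  assert (Rc : radius_of_convexity (struve_v nu) = Finite rc).
  { rewrite radius_of_convexity_eq.
    apply radius_of_uniform_convexity_struve_v; auto; try lra. intros x Hx. apply HGpos. lra. }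
  assert (Ru : radius_of_uniform_convexity beta alpha (struve_v nu) = Finite r0).
  { apply radius_of_uniform_convexity_struve_v; auto; try lra. intros x Hx. apply HGpos. lra. }
  split.
  - exists r0. split; auto. split; [lra|split].
    + apply uniform_convexity_root_iff; auto; [lra|]. split; auto.
      apply Rgt_not_eq. apply HGpos. lra.
    + intros x Hx Hroot. apply uniform_convexity_root_iff in Hroot as [_ Hroot]; auto.
      destruct (Rle_lt_dec r0 x); auto. specialize (Hr0pos x ltac:(lra)). lra.
  - exists h, s. rewrite Rc, Ru. repeat split; try lra.
    + rewrite struve_real, PSeries_struve_v by (auto; lra). fold m (F h).
      rewrite HFh. f_equal. ring.
    + intros x Hx Hz. rewrite struve_real, PSeries_struve_v in Hz by auto. fold m (F x) in Hz.
      apply RtoC_inj in Hz. pose proof (struve_factor_pos nu x hnu Hx).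
      destruct (Rle_lt_dec h x); auto. specialize (HFpos x ltac:(lra)).
      assert (0 < struve_factor nu x * (x * F x)) 
        by (apply Rmult_lt_0_compat; [|apply Rmult_lt_0_compat]; auto).
      lra.
    + rewrite C_derive_struve_v, CPS_struve_dv, <- RtoC_pow, CPS_RtoC by auto.
      fold m (G s). now rewrite HGs.
    + intros x Hx Hz. rewrite C_derive_struve_v, CPS_struve_dv, <- RtoC_pow, CPS_RtoC in Hz by auto.
      fold m (G x) in Hz. apply RtoC_inj in Hz.
      destruct (Rle_lt_dec s x); auto. specialize (HGpos x ltac:(lra)). lra.
    + simpl. lra.
    + intros Hpos. simpl. destruct (Req_dec r0 rc) as [E0|Hne]; [|lra].
      rewrite E0, Hgap in Hgr0. nra.
    + simpl. lra.
Qed.
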